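(* Let $g$ be a disjunctive sum of finitely many BIPASS strips. Then the atomic weight of $g$ equals its $\Delta$-excess: $\mathrm{aw}(g)=\Delta(g)$.
   Context: **BIPASS.** A strip is a finite word over $\{B,W\}$ ($B$ = black stone, $W$ = white stone). Dead stones are removed immediately: a white stone with no black stone to its left, and a black stone with no white stone to its right, are deleted. So a strip is either the empty word (the game $0$) or a word beginning with $B$ and ending with $W$. A Left move chooses a black stone at position $i$ and a white stone at position $j>i$ with no black stone strictly between them, and interchanges the two; a Right move chooses a black stone at position $i$ and a white stone at position $j>i$ with no white stone strictly between them, and interchanges the two. After a move, dead stones (all leading $W$'s and all trailing $B$'s) are deleted. A BIPASS position is a disjunctive sum of finitely many strips, under normal play (a player who cannot move loses). All such games are all-small: in every subposition, Left has a move if and only if Right has a move. **$\Delta$-excess.** For a strip $s$, $\Delta(s)=w(s)-b(s)$, where $w(s)$ and $b(s)$ are the numbers of white and black stones of $s$; for a sum $g=g_1+\cdots+g_n$ of strips, $\Delta(g)=\sum_i\Delta(g_i)$. **Atomic weight.** Games are short normal-play partizan games, $o(\cdot)$ is the outcome, and $*m$ denotes the nim-heap of size $m$, with $*=*1=\{0\mid 0\}$. Let $\uparrow=\{0\mid *\}$, $\downarrow=-\uparrow$, $\Uparrow *=\uparrow+\uparrow+*$ and $\Downarrow *=\downarrow+\downarrow+*$. Far star $\bigstar$ is an arbitrarily large nim-heap (both players may move from it to any nim-heap, and $\bigstar+\bigstar=\bigstar$); concretely, for a short game $Y$, $o(Y+\bigstar)$ is the common value of $o(Y+*m)$ for all sufficiently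 large $m$. Write $G=_{\bigstar}H$ if $o(G+X+\bigstar)=o(H+X+\bigstar)$ for all games $X$. The product $G\cdot\uparrow$ is defined as follows: if $G$ equals an integer $n$, it is the sum of $n$ copies of $\uparrow$ (the sum of $|n|$ copies of $\downarrow$ if $n<0$, and $0$ if $n=0$); otherwise $G\cdot\uparrow=\{G^L\cdot\uparrow+\Uparrow *\mid G^R\cdot\uparrow+\Downarrow *\}$, with $G^L,G^R$ ranging over the Left and Right options of $G$. For an all-small game $g$ there is a unique (up to equality of game values) game $G$ with $G\cdot\uparrow=_{\bigstar}g$, and $\mathrm{aw}(g)$ is defined to be this $G$. *)

(* Defs.v *)
From HB Require Import structures.
From mathcomp Require Import all_boot all_algebra zify.
From Stdlib Require Import ClassicalEpsilon.
Set Implicit Arguments. Unset Strict Implicit. Unset Printing Implicit Defensive.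
Import GRing.Theory.

(** * Short partizan games under normal play *)

Inductive player := Left | Right.

Definition opponent (p : player) : player :=
  match p with Left => Right | Right => Left end.

(* A game form: the finite list of Left options, then that of Right options. *)
Inductive game := Game of seq game & seq game.

Definition game_zero : game := Game [::] [::].

Fixpoint game_neg (G : game) : game :=
  let: Game GL GR := G in
  Game [seq game_neg H | H <- GR] [seq game_neg H | H <- GL].

Fixpoint game_add (G : game) : game -> game :=
  fix addG (H : game) : game :=
    match G, H with
    | Game GL GR, Game HL HR =>
        Game ([seq game_add G' H | G' <- GL] ++ [seq addG H' | H' <- HL])
             ([seq game_add G' H | G' <- GR] ++ [seq addG H' | H' <- HR])
    end.

(* [wins_first p G]: player [p], moving first on [G], has a winning strategy. *)
Fixpoint wins_first (p : player) (G : game) : bool :=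
  match G with
  | Game GL GR =>
      has (fun H => ~~ wins_first (opponent p) H)
          (match p with Left => GL | Right => GR end)
  end.

Inductive outcome_class := OutL | OutR | OutN | OutP.

Definition game_outcome (G : game) : outcome_class :=
  match wins_first Left G, wins_first Right G with
  | true, false => OutL
  | false, true => OutR
  | true, true => OutN
  | false, false => OutP
  end.

(* Equality of game values. *)
Definition game_eq (G H : game) : Prop :=
  forall X : game, game_outcome (game_add G X) = game_outcome (game_add H X).

Definition copies (n : nat) (G : game) : game := iter n (game_add G) game_zero.

(* n = {n - 1 | } *)
Fixpoint nat_game (n : nat) : game :=
  if n is k.+1 then Game [:: nat_game k] [::] else game_zero.

Definition int_game (n : int) : game :=
  match n with
  | Posz k => nat_game k
  | Negz k => game_neg (nat_game k.+1)
  end.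

(* [nim_options m] is [:: *0; *1; ...; *(m-1)]. *)
Fixpoint nim_options (m : nat) : seq game :=
  if m is k.+1 then rcons (nim_options k) (Game (nim_options k) (nim_options k))
  else [::].

Definition nim (m : nat) : game := Game (nim_options m) (nim_options m).

Definition star : game := nim 1.
Definition up : game := Game [:: game_zero] [:: star].
Definition down : game := game_neg up.
Definition double_up_star : game := game_add (game_add up up) star.
Definition double_down_star : game := game_add (game_add down down) star.

(** * Far star and atomic weight *)

(* o(Y + far star) is [o]. *)
Definition far_outcome (Y : game) (o : outcome_class) : Prop :=
  exists N : nat, forall m : nat, N <= m -> game_outcome (game_add Y (nim m)) = o.

(* For each X, o(G + X + far star) and o(H + X + far star) exist and agree. *)
Definition far_eq (G H : game) : Prop :=
  forall X : game, exists o : outcome_class,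
    far_outcome (game_add G X) o /\ far_outcome (game_add H X) o.

(* [Some n] if G equals, as a value, the (necessarily unique) integer n. *)
Definition integer_value (G : game) : option int :=
  if excluded_middle_informative (exists n : int, game_eq G (int_game n))
  then Some (epsilon (inhabits (Posz 0)) (fun n => game_eq G (int_game n)))
  else None.

Definition int_times_up (n : int) : game :=
  match n with
  | Posz k => copies k up
  | Negz k => copies k.+1 down
  end.

Fixpoint times_up (G : game) : game :=
  match G with
  | Game GL GR =>
      match integer_value G with
      | Some n => int_times_up n
      | None => Game [seq game_add (times_up G') double_up_star | G' <- GL]
                     [seq game_add (times_up G') double_down_star | G' <- GR]
      end
  end.

(* A representative of the atomic weight, which is a game up to [game_eq].
   Meaningful for all-small [g], where such a G exists and is unique up to
   [game_eq]; an arbitrary game if no G satisfies the predicate. *)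
Definition aw (g : game) : game :=
  epsilon (inhabits game_zero) (fun G => far_eq (times_up G) g).

(** * BIPASS *)

Inductive stone := B | W.

Definition is_white (x : stone) : bool := if x is W then true else false.
Definition stone_of_bool (b : bool) : stone := if b then W else B.
Lemma is_whiteK : cancel is_white stone_of_bool. Proof. by case. Qed.
HB.instance Definition _ := Equality.copy stone (can_type is_whiteK).

(* A position on the board: no dead stone is left. *)
Definition is_strip (s : seq stone) : bool :=
  (s == [::]) || (head W s == B) && (last B s == W).

Definition drop_leading (x : stone) (s : seq stone) : seq stone :=
  drop (find (predC1 x) s) s.

Definition remove_dead (s : seq stone) : seq stone :=
  rev (drop_leading B (rev (drop_leading W s))).

Definition swap (s : seq stone) (i j : nat) : seq stone :=
  set_nth B (set_nth B s i (nth B s j)) j (nth B s i).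

(* The colour of the stones that a player may not jump over. *)
Definition colour (p : player) : stone :=
  match p with Left => B | Right => W end.

Definition legal (p : player) (s : seq stone) (i j : nat) : bool :=
  [&& i < j < size s, nth B s i == B, nth B s j == W
    & all (fun k => nth B s k != colour p) (iota i.+1 (j - i.+1))].

Definition moves (p : player) (s : seq stone) : seq (seq stone) :=
  [seq remove_dead (swap s ij.1 ij.2)
    | ij <- [seq (i, j) | i <- iota 0 (size s), j <- iota 0 (size s)]
    & legal p s ij.1 ij.2].

(* The number of pairs formed by a black stone and a white stone to its right;
   it decreases at each move. *)
Fixpoint pairs (s : seq stone) : nat :=
  match s with
  | [::] => 0
  | B :: s' => count_mem W s' + pairs s'
  | W :: s' => pairs s'
  end.

(* The game tree of [s] truncated at depth [n]. *)
Fixpoint strip_tree (n : nat) (s : seq stone) : game :=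
  if n is k.+1 then Game [seq strip_tree k t | t <- moves Left s]
                         [seq strip_tree k t | t <- moves Right s]
  else game_zero.

(* No truncation takes place at depth [pairs s]: see [strip_gameE]. *)
Definition strip_game (s : seq stone) : game := strip_tree (pairs s) s.

Lemma pairs_cat s t :
  pairs (s ++ t) = pairs s + pairs t + count_mem B s * count_mem W t.
Proof. by elim: s => [|[] s IH] /=; rewrite ?count_cat ?IH /=; nia. Qed.

Lemma pairs_remove_dead s : pairs (remove_dead s) <= pairs s.
Proof.
rewrite /remove_dead /drop_leading; move: (find _ s) => k; move: (find _ _) => n.
apply: (@leq_trans (pairs (drop k s))).
  rewrite -{2}(revK (drop k s)) -{2}(cat_take_drop n (rev (drop k s))) rev_cat.
  by rewrite pairs_cat -addnA leq_addr.
by rewrite -{2}(cat_take_drop k s) pairs_cat addnAC leq_addl.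
Qed.

Lemma pairs_swap p s i j : legal p s i j -> pairs (swap s i j) < pairs s.
Proof.
case/and4P=> /andP[lt_ij lt_js] /eqP si /eqP sj _.
have lt_is := ltn_trans lt_ij lt_js.
pose u := take i s; pose m := take (j - i.+1) (drop i.+1 s); pose v := drop j.+1 s.
have szu : size u = i by rewrite size_takel // ltnW.
have szm : size m = j - i.+1 by rewrite size_takel // size_drop leq_sub2r // ltnW.
have def_s : s = u ++ B :: m ++ W :: v.
  rewrite -{1}(cat_take_drop i s) (drop_nth B lt_is) si; congr (_ ++ _ :: _).
  rewrite -{1}(cat_take_drop (j - i.+1) (drop i.+1 s)) drop_drop subnK //.
  by rewrite (drop_nth B lt_js) sj.
have set_cat (x y : stone) a b n :
    n = size a -> set_nth B (a ++ x :: b) n y = a ++ y :: b.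
  by move=> ->; elim: a => //= z a ->.
have -> : swap s i j = u ++ W :: m ++ B :: v.
  rewrite /swap si sj def_s set_cat ?szu // -cat_cons catA set_cat -?catA //.
  by rewrite size_cat /= szu szm; lia.
rewrite def_s !(pairs_cat, count_cat) /= !pairs_cat /= !count_cat /=.
nia.
Qed.

Lemma pairs_moves p s t : t \in moves p s -> pairs t < pairs s.
Proof.
case/mapP=> -[i j]; rewrite mem_filter => /andP[/= leg _] ->.
exact: leq_ltn_trans (pairs_remove_dead _) (pairs_swap leg).
Qed.

Lemma strip_tree_ext n m s :
  pairs s <= n -> pairs s <= m -> strip_tree n s = strip_tree m s.
Proof.
have moves0 p t : pairs t <= 0 -> moves p t = [::].
  move=> t0; case def_m: (moves p t) => [|x l] //.
  have /pairs_moves : x \in moves p t by rewrite def_m mem_head.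
  by rewrite ltnNge (leq_trans t0).
elim: n m s => [|n IH] [|m] s //= sn sm; [by rewrite !moves0 | by rewrite !moves0 |].
by congr Game; apply/eq_in_map => t /pairs_moves lt_t; apply: IH; lia.
Qed.

Lemma strip_gameE s :
  strip_game s = Game [seq strip_game t | t <- moves Left s]
                      [seq strip_game t | t <- moves Right s].
Proof.
rewrite {1}/strip_game (@strip_tree_ext _ (pairs s).+1) //=.
by congr Game; apply/eq_in_map => t /pairs_moves lt_t;
  apply: strip_tree_ext; lia.
Qed.

Definition position_game (g : seq (seq stone)) : game :=
  foldr game_add game_zero [seq strip_game s | s <- g].

Definition strip_excess (s : seq stone) : int :=
  ((count_mem W s)%:Z - (count_mem B s)%:Z)%R.

Definition excess (g : seq (seq stone)) : int :=
  (\sum_(s <- g) strip_excess s)%R.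

(* Main.v *)
Require Import Defs.
From mathcomp Require Import all_boot all_algebra zify.
From Stdlib Require Import ClassicalEpsilon Setoid Morphisms.
Set Implicit Arguments. Unset Strict Implicit. Unset Printing Implicit Defensive.
Import GRing.Theory.

(** Write Delta for the excess, [U n] for the sum of n copies of up (of down if
    n is negative) and say that a game is non-negative with a far star when Left
    wins it moving second after any sufficiently large nim heap is added.  The
    theorem splits into two statements: a position g satisfies
    g =_far [U (Delta g)] ([position_far_eq]), and an arbitrary game G with
    G.up =_far [U n] equals the integer n ([times_up_far_inj]).  Together they
    determine the choice made in the definition of the atomic weight.

    First statement.  Up and down are themselves strips, BWW and BBW, so after
    adding [U (- Delta g)] it is enough to see that a position h with
    Delta h = 0 can be added to any game X without changing its outcome in the
    presence of a far star.  By mirror symmetry it suffices that h with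
    Delta h >= 0 never hurts Left ([position_add_far]).  Two facts on moves are
    used: a Right move lowers Delta by at most 1, and Left can raise Delta by 1
    as soon as some strip has two black stones, by pushing its last black stone
    off the right end.  Hence Left answers a Right move in h by restoring
    Delta, and answers moves in X by the strategy for X.  If instead every strip
    has at most one black stone, then Delta h >= 0 automatically and h is at
    least some nimber, which a far star absorbs.  The one delicate case is Right
    replacing the far star by a small heap: X is non-negative with a far star,
    so Left can win X plus any small heap moving first, and h cannot spoil that
    because one more unit of excess beats every nimber ([ahead_nim],
    [position_add_nim]).

    Second statement.  For a non-integral G the relations n <= G and n <| G
    (less than or confused with) are read off the options of G alone, as moves
    in n can be ignored ([lf_int_option]).  A Left move in G.up gains two copies
    of up, which compensates exactly for the tempo, so by induction the sign of
    G - n is visible on the outcome of G.up - n.up, up to one copy of up and a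
    far star ([times_up_far]).  If G.up =_far n.up these outcomes are those of
    up and down, which forces n <= G and G <= n. *)

(** * Options *)

(** Games carry no decidable equality in what follows, so membership in a list
    of options is the propositional one. *)
Definition is_option (p : player) (G H : game) : Prop :=
  let: Game GL GR := G in List.In H (if p is Left then GL else GR).

Fixpoint game_size (G : game) : nat :=
  let: Game GL GR := G in
  (sumn (map game_size GL) + sumn (map game_size GR)).+1.

Notation "G '+g' H" := (game_add G H) (at level 50, left associativity).
Notation "'-g' G" := (game_neg G) (at level 35, right associativity).

Lemma In_map (T U : Type) (f : T -> U) s y :
  List.In y (map f s) <-> exists2 x, List.In x s & y = f x.
Proof.
elim: s => [|x s IH] /=; first by split=> // -[].
rewrite IH; split=> [[<-|[z zs ->]]|[z [<-|zs] ->]]; try by [left].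
- by exists x; [left|].
- by exists z; [right|].
- by right; exists z.
Qed.

Lemma In_cat (T : Type) (s t : seq T) x :
  List.In x (s ++ t) <-> List.In x s \/ List.In x t.
Proof. exact: List.in_app_iff. Qed.

Lemma In_rcons (T : Type) (s : seq T) x y :
  List.In x (rcons s y) <-> List.In x s \/ x = y.
Proof. rewrite -cats1 In_cat /=; intuition. Qed.

Lemma In_mem (T : eqType) (s : seq T) x : List.In x s <-> x \in s.
Proof.
elim: s => [|y s IH] //=; rewrite inE IH eq_sym.
by split=> [[->|->]|/orP[/eqP|]]; rewrite ?eqxx ?orbT; auto.
Qed.

Lemma option_size p G H : is_option p G H -> game_size H < game_size G.
Proof.
case: G => GL GR /= HG.
have In_sumn s : List.In H s -> game_size H <= sumn (map game_size s).
  elim: s => //= K s IH [->|/IH]; first exact: leq_addr.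
  by move/leq_trans; apply; apply: leq_addl.
by case: p HG => /In_sumn; lia.
Qed.

Lemma game_ind_options (P : game -> Prop) :
  (forall G, (forall p H, is_option p G H -> P H) -> P G) -> forall G, P G.
Proof.
move=> IP G; move: {2}(game_size G).+1 (ltnSn (game_size G)) => n.
elim: n G => // n IH G ltGn; apply: IP => p H /option_size ltHG.
by apply: IH; lia.
Qed.

Lemma wins_firstP p G :
  wins_first p G <-> exists2 H, is_option p G H & ~~ wins_first (opponent p) H.
Proof.
case: G => GL GR /=; move: (match p with Left => GL | Right => GR end) => s.
elim: s => [|K s IH] /=; first by split=> // -[].
split=> [/orP[KN|/IH[H Hs HN]]|[H [<- ->|Hs HN]] //].
- by exists K; [left|].
- by exists H; [right|].
- by apply/orP; right; apply/IH; exists H.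
Qed.

Lemma wins_firstPn p G :
  ~~ wins_first p G <-> forall H, is_option p G H -> wins_first (opponent p) H.
Proof.
split=> [GN H HG|GN].
  by apply: contraNT GN => HN; apply/wins_firstP; exists H.
by apply/negP => /wins_firstP[H /GN ->].
Qed.

Lemma option_add p G H K : is_option p (G +g H) K <->
  (exists2 G', is_option p G G' & K = G' +g H) \/
  (exists2 H', is_option p H H' & K = G +g H').
Proof. by case: G H => GL GR [HL HR]; case: p => /=; rewrite In_cat !In_map. Qed.

Lemma option_addl p G H G' : is_option p G G' -> is_option p (G +g H) (G' +g H).
Proof. by move=> ?; apply/option_add; left; exists G'. Qed.

Lemma option_addr p G H H' : is_option p H H' -> is_option p (G +g H) (G +g H').
Proof. by move=> ?; apply/option_add; right; exists H'. Qed.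

Lemma option_neg p G K : is_option p (-g G) K <->
  exists2 G', is_option (opponent p) G G' & K = -g G'.
Proof. by case: G => GL GR; case: p => /=; rewrite In_map. Qed.

Lemma option_nim p m K : is_option p (nim m) K <-> exists2 k, k < m & K = nim k.
Proof.
have ->: is_option p (nim m) K <-> List.In K (nim_options m) by case: p.
elim: m => [|m IH] /=; first by split=> // -[].
rewrite In_rcons IH; split=> [[[k km ->]|->]|[k km ->]].
- by exists k => //; apply: ltnW.
- by exists m.
- by move: km; rewrite ltnS leq_eqVlt => /orP[/eqP->|km]; [right|left; exists k].
Qed.

Lemma option_zero p K : ~ is_option p game_zero K.
Proof. by case: p. Qed.

Lemma opponentK p : opponent (opponent p) = p. Proof. by case: p. Qed.

Lemma eq_map_In (T U : Type) (f g : T -> U) s :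
  (forall x, List.In x s -> f x = g x) -> map f s = map g s.
Proof.
elim: s => //= x s IH fg; rewrite fg ?IH //; last by left.
by move=> y ys; apply: fg; right.
Qed.

Lemma negK G : -g -g G = G.
Proof.
elim/game_ind_options: G => -[GL GR] IH /=.
rewrite -!map_comp; congr Game; rewrite -[RHS]map_id; apply: eq_map_In => H HG.
- exact: (IH Left).
- exact: (IH Right).
Qed.

Lemma negD G H : -g (G +g H) = -g G +g -g H.
Proof.
elim/game_ind_options: G H => -[GL GR] IHG; elim/game_ind_options=> -[HL HR] IHH.
rewrite /= !map_cat -!map_comp; congr Game; congr cat; apply: eq_map_In => K KG /=.
- exact: (IHG Right).
- exact: (IHH Right).
- exact: (IHG Left).
- exact: (IHH Left).
Qed.

Lemma addg0 G : G +g game_zero = G.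
Proof.
elim/game_ind_options: G => -[GL GR] IH /=.
rewrite !cats0; congr Game; rewrite -[RHS]map_id; apply: eq_map_In => H HG.
- exact: (IH Left).
- exact: (IH Right).
Qed.

Lemma add0g G : game_zero +g G = G.
Proof.
elim/game_ind_options: G => -[GL GR] IH /=.
congr Game; rewrite -[RHS]map_id; apply: eq_map_In => H HG.
- exact: (IH Left).
- exact: (IH Right).
Qed.

Lemma neg_nim m : -g (nim m) = nim m.
Proof.
suff E : map game_neg (nim_options m) = nim_options m by rewrite /nim /= E.
by elim: m => //= m IH; rewrite map_rcons /= IH.
Qed.

(** * The order on game values *)

Definition game_le G H := ~~ wins_first Right (H +g -g G).
(** G is less than or confused with H. *)
Definition game_lf G H := wins_first Left (H +g -g G).
Notation "G '<=g' H" := (game_le G H) (at level 70).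
Notation "G '<|g' H" := (game_lf G H) (at level 70).

Lemma le0E G : (game_zero <=g G) = ~~ wins_first Right G.
Proof. by rewrite /game_le addg0. Qed.

Lemma lf0E G : (game_zero <|g G) = wins_first Left G.
Proof. by rewrite /game_lf addg0. Qed.

(** The moves in H - G are those of H and, with the players exchanged, those
    of G; this is Conway's recursive definition of the order. *)
Lemma game_leP G H : G <=g H <->
  (forall K, is_option Left G K -> K <|g H) /\
  (forall K, is_option Right H K -> G <|g K).
Proof.
rewrite /game_le wins_firstPn /game_lf; split=> [GH|[GH1 GH2] K].
  split=> K KG; apply: GH; last exact: option_addl.
  by apply/option_addr/option_neg; exists K.
by case/option_add=> [[K' /GH2 ? ->//]|[K' /option_neg[K2 /GH1 ? ->] ->]].
Qed.

Lemma game_lfP G H : G <|g H <->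
  (exists2 K, is_option Left H K & G <=g K) \/
  (exists2 K, is_option Right G K & K <=g H).
Proof.
rewrite /game_lf wins_firstP /game_le; split=> [[K]|].
  case/option_add=> [[K' HK' ->]|[K' /option_neg[K2 GK2 ->] ->]] ?.
  - by left; exists K'.
  - by right; exists K2.
case=> -[K HK ?]; first by exists (K +g -g G); first exact: option_addl.
by exists (H +g -g K) => //; apply/option_addr/option_neg; exists K.
Qed.

Lemma lf_left G H K : is_option Left H K -> G <=g K -> G <|g H.
Proof. by move=> HK GK; apply/game_lfP; left; exists K. Qed.

Lemma lf_right G H K : is_option Right G K -> K <=g H -> G <|g H.
Proof. by move=> HK GK; apply/game_lfP; right; exists K. Qed.

Lemma le_left G H K : G <=g H -> is_option Left G K -> K <|g H.
Proof. by move/game_leP => [GH _]; apply: GH. Qed.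

Lemma le_right G H K : G <=g H -> is_option Right H K -> G <|g K.
Proof. by move/game_leP => [_ GH]; apply: GH. Qed.

(** The two sides speak of the outcomes of two different sums, that of H with
    the negative of G and that of G with the negative of H; that these agree is
    where negation, a formal exchange of the players, is seen to be an
    opposite. *)
Lemma not_le G H : ~~ (G <=g H) = (H <|g G).
Proof.
move: {2}(game_size G + game_size H).+1 (ltnSn (game_size G + game_size H)) => n.
elim: n G H => // n IH G H ltn.
apply/idP/idP => [GH|HG]; last first.
  apply/negP => /game_leP[GL HR]; case/game_lfP: HG => -[K KG].
    by move=> HK; have:= GL _ KG; rewrite -IH ?HK //; have:= option_size KG; lia.
  by move=> HK; have:= HR _ KG; rewrite -IH ?HK //; have:= option_size KG; lia.
apply: contraNT GH => HG; apply/game_leP; split=> K KG; have lt:= option_size KG.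
  by rewrite -IH; [apply: contra HG => HK; apply: lf_left KG HK|lia].
by rewrite -IH; [apply: contra HG => HK; apply: lf_right KG HK|lia].
Qed.

Lemma not_lf G H : ~~ (G <|g H) = (H <=g G).
Proof. by rewrite -not_le negbK. Qed.

Lemma le_refl G : G <=g G.
Proof.
elim/game_ind_options: G => G IH; apply/game_leP.
by split=> K KG; [apply: lf_left KG (IH _ _ KG)|apply: lf_right KG (IH _ _ KG)].
Qed.

(** An option that refutes G <= K gives, by induction on the total size, a
    contradiction with one of the two hypotheses: the triple is permuted
    cyclically and one game is replaced by an option. *)
Lemma le_trans H G K : G <=g H -> H <=g K -> G <=g K.
Proof.
move: {2}(_ + _ + _).+1 (ltnSn (game_size G + game_size H + game_size K)) => n.
elim: n G H K => // n IH G H K ltn GH HK.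
apply/game_leP; split=> L LG; rewrite -not_le; apply/negP; have ltL:= option_size LG.
  move/(IH _ _ _ _ HK) => HL; have := le_left GH LG.
  by rewrite -not_le HL //; lia.
move=> LGle; have:= le_right HK LG.
by rewrite -not_le (IH _ _ _ _ LGle GH) //; lia.
Qed.

Lemma lf_le_trans H G K : G <|g H -> H <=g K -> G <|g K.
Proof. by rewrite -!not_le => + HK; apply: contra; apply: le_trans. Qed.

Definition game_equiv G H : Prop := (G <=g H) /\ (H <=g G).
Notation "G '=g' H" := (game_equiv G H) (at level 70).

#[export] Instance game_equiv_equivalence : Equivalence game_equiv.
Proof.
split=> [G|G H []|G H K [GH HG] [HK KH]]; first by split; apply: le_refl.
  by split.
by split; [apply: le_trans GH HK|apply: le_trans KH HG].
Qed.

Lemma equiv_refl G : G =g G. Proof. reflexivity. Qed.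
#[local] Hint Resolve le_refl equiv_refl : core.

#[export] Instance game_le_proper :
  Proper (game_equiv ==> game_equiv ==> eq) game_le.
Proof.
move=> G G' [GG' G'G] H H' [HH' H'H]; apply/idP/idP => GH.
  exact: le_trans (le_trans G'G GH) HH'.
exact: le_trans (le_trans GG' GH) H'H.
Qed.

#[export] Instance game_lf_proper :
  Proper (game_equiv ==> game_equiv ==> eq) game_lf.
Proof. by move=> G G' GG' H H' HH'; rewrite -!not_le GG' HH'. Qed.

(** Used for the identities of games that fail as equalities only because the
    lists of options come in another order. *)
Lemma equiv_options G H :
  (forall p K, is_option p G K -> exists2 K', is_option p H K' & K =g K') ->
  (forall p K, is_option p H K -> exists2 K', is_option p G K' & K =g K') ->
  G =g H.
Proof.
move=> GH HG; split; apply/game_leP; split=> K KG.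
- by have [K' K'H [KK' _]] := GH _ _ KG; apply: lf_left KK'.
- by have [K' K'H [_ KK']] := HG _ _ KG; apply: lf_right KK'.
- by have [K' K'H [KK' _]] := HG _ _ KG; apply: lf_left KK'.
- by have [K' K'H [_ KK']] := GH _ _ KG; apply: lf_right KK'.
Qed.

Lemma addgC G H : G +g H =g H +g G.
Proof.
elim/game_ind_options: G H => G IHG; elim/game_ind_options=> H IHH.
apply: equiv_options => p K /option_add[] [K' K'o ->].
- exists (H +g K'); [exact: option_addr|exact: IHG K'o _].
- exists (K' +g G); [exact: option_addl|exact: IHH K'o].
- exists (G +g K'); [exact: option_addr|symmetry; exact: IHH K'o].
- exists (K' +g H); [exact: option_addl|symmetry; exact: IHG K'o _].
Qed.

Lemma addgA G H K : G +g (H +g K) =g G +g H +g K.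
Proof.
elim/game_ind_options: G H K => G IHG; elim/game_ind_options=> H IHH.
elim/game_ind_options=> K IHK; apply: equiv_options => p L /option_add[] [L' L'o ->].
- exists (L' +g H +g K); [exact/option_addl/option_addl|exact: IHG L'o _ _].
- case/option_add: L'o => -[L2 L2o ->].
    exists (G +g L2 +g K); [exact/option_addl/option_addr|exact: IHH L2o _].
  exists (G +g H +g L2); [exact/option_addr|exact: IHK L2o].
- case/option_add: L'o => -[L2 L2o ->].
    exists (L2 +g (H +g K)); [exact/option_addl|symmetry; exact: IHG L2o _ _].
  exists (G +g (L2 +g K)); [exact/option_addr/option_addl|symmetry; exact: IHH L2o _].
- exists (G +g (H +g L')); [exact/option_addr/option_addr|symmetry; exact: IHK L'o].
Qed.

Lemma le_lf_add K G H :
  (G <=g H -> G +g K <=g H +g K) /\ (G <|g H -> G +g K <|g H +g K).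
Proof.
move: {2}(_ + _ + _).+1 (ltnSn (game_size G + game_size H + game_size K)) => n.
elim: n G H K => // n IH G H K ltn; split=> [GH|/game_lfP[] [L Lo GH]].
- apply/game_leP; split=> L /option_add[] [L' L'o ->]; have lt:= option_size L'o.
  + by apply: (proj2 (IH _ _ _ _)); [lia|apply: le_left L'o].
  + apply: (lf_left (K := H +g L')); first exact: option_addr.
    by apply: (proj1 (IH _ _ _ _)) => //; lia.
  + by apply: (proj2 (IH _ _ _ _)); [lia|apply: le_right L'o].
  + apply: (lf_right (K := G +g L')); first exact: option_addr.
    by apply: (proj1 (IH _ _ _ _)) => //; lia.
- apply: (lf_left (K := L +g K)); first exact: option_addl.
  by apply: (proj1 (IH _ _ _ _)) => //; have:= option_size Lo; lia.
- apply: (lf_right (K := L +g K)); first exact: option_addl.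
  by apply: (proj1 (IH _ _ _ _)) => //; have:= option_size Lo; lia.
Qed.

Lemma le_addr K G H : G <=g H -> G +g K <=g H +g K.
Proof. exact: (proj1 (le_lf_add _ _ _)). Qed.

#[export] Instance game_add_proper :
  Proper (game_equiv ==> game_equiv ==> game_equiv) game_add.
Proof.
move=> G G' [GG' G'G] H H' [HH' H'H]; transitivity (G' +g H).
  by split; apply: le_addr.
rewrite (addgC _ H) (addgC _ H'); split; exact: le_addr.
Qed.

Lemma le_neg G H : (-g G <=g -g H) = (H <=g G).
Proof. by rewrite /game_le -!le0E negK; rewrite (addgC (-g H)). Qed.

Lemma lf_neg G H : (-g G <|g -g H) = (H <|g G).
Proof. by rewrite -!not_le le_neg. Qed.

#[export] Instance game_neg_proper : Proper (game_equiv ==> game_equiv) game_neg.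
Proof. by move=> G H [GH HG]; split; rewrite le_neg. Qed.

Lemma addgN G : G +g -g G =g game_zero.
Proof.
have ge0 H : game_zero <=g H +g -g H by rewrite le0E; apply: le_refl.
split; last exact: ge0.
by rewrite -le_neg negD negK (addgC (-g G)); apply: ge0.
Qed.

Lemma addgCA G H K : G +g (H +g K) =g H +g (G +g K).
Proof. by rewrite !addgA (addgC G). Qed.

Lemma addgAC G H K : G +g H +g K =g G +g K +g H.
Proof. by rewrite -!addgA (addgC H). Qed.

Lemma addgACA G H K L : G +g H +g (K +g L) =g G +g K +g (H +g L).
Proof. by rewrite -!addgA (addgCA H). Qed.

Lemma le_addl K G H : G <=g H -> K +g G <=g K +g H.
Proof. by rewrite !(addgC K); apply: le_addr. Qed.

Lemma addg_ge0 G H : game_zero <=g G -> game_zero <=g H -> game_zero <=g G +g H.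
Proof. by move=> G0 /(le_addl G); rewrite addg0; apply: le_trans. Qed.

Lemma addg_ge0_gf0 G H :
  game_zero <=g G -> game_zero <|g H -> game_zero <|g G +g H.
Proof. by move=> /(le_addr H) + H0; rewrite add0g; apply: lf_le_trans. Qed.

Lemma ge0P G : game_zero <=g G <-> forall K, is_option Right G K -> game_zero <|g K.
Proof.
rewrite game_leP; split=> [[]//|GR]; split=> // K /option_zero [].
Qed.

Lemma outcome_eqP G H : game_outcome G = game_outcome H <->
  ((game_zero <=g G) = (game_zero <=g H)) /\ ((game_zero <|g G) = (game_zero <|g H)).
Proof.
rewrite /game_outcome !le0E !lf0E.
by do 4 case: (wins_first _ _); split=> // -[].
Qed.

(** Testing the definition of equality against X = - H is enough, and
    conversely the order is compatible with sums. *)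
Lemma game_eqP G H : game_eq G H <-> G =g H.
Proof.
split=> [GH|GH X]; last by apply/outcome_eqP; rewrite GH.
have eq0 K : (game_zero <=g K) /\ ~~ (game_zero <|g K) -> K =g game_zero.
  by rewrite not_lf => -[].
have E : G +g -g H =g game_zero.
  apply: eq0; have /outcome_eqP[-> ->] := GH (-g H).
  by rewrite addgN le_refl -not_le le_refl.
by rewrite -[G]addg0 -(addgN H) (addgC H) addgA E add0g.
Qed.

(** * Nim heaps *)

Lemma lf_nim a b : a != b -> nim a <|g nim b.
Proof.
rewrite neq_ltn => /orP[ab|ba].
  by apply: (lf_left (K := nim a)); [apply/option_nim; exists a|apply: le_refl].
by apply: (lf_right (K := nim b)); [apply/option_nim; exists b|apply: le_refl].
Qed.

Lemma nim_inj a b : nim a =g nim b -> a = b.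
Proof. by move=> [_]; apply: contraTeq => /lf_nim; rewrite -not_le. Qed.

(** Nim addition without the binary expansion: the value of the sum is the
    least c that is not the value of an option. The bound c <= a + b provides
    a candidate for that least value. *)
Lemma nim_sum a b : exists2 c, c <= a + b & nim a +g nim b =g nim c.
Proof.
move: {2}(a + b).+1 (ltnSn (a + b)) => n; elim: n a b => // n IH a b ltn.
pose eqb G H := (G <=g H) && (H <=g G).
pose S x := [exists a' : 'I_a, eqb (nim a' +g nim b) (nim x)]
         || [exists b' : 'I_b, eqb (nim a +g nim b') (nim x)].
have SP x : S x <-> exists2 K, K =g nim x & forall p, is_option p (nim a +g nim b) K.
  split=> [/orP[]/existsP[i /andP[ix xi]]|[K Kx /(_ Left)/option_add[]]].
  - exists (nim i +g nim b) => // p.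
    by apply/option_addl/option_nim; exists (val i); first exact: ltn_ord.
  - exists (nim a +g nim i) => // p.
    by apply/option_addr/option_nim; exists (val i); first exact: ltn_ord.
  - case=> _ /option_nim[k ka ->] EK; apply/orP; left; apply/existsP.
    by exists (Ordinal ka); apply/andP; rewrite -EK.
  - case=> _ /option_nim[k kb ->] EK; apply/orP; right; apply/existsP.
    by exists (Ordinal kb); apply/andP; rewrite -EK.
have optS p K : is_option p (nim a +g nim b) K -> exists2 x, S x & K =g nim x.
  have sym x : K =g nim x -> is_option p (nim a +g nim b) K -> S x.
    move=> Kx Ko; apply/SP; exists K => // q.
    case/option_add: Ko => -[_ /option_nim[k lk ->] ->].
      by apply/option_addl/option_nim; exists k.
    by apply/option_addr/option_nim; exists k.
  move=> Ko; case/option_add: (Ko) => -[_ /option_nim[k lk ->] EK].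
    have [|x _ Ex] := IH k b; first by lia.
    by exists x; rewrite ?EK //; apply: sym => //; rewrite EK.
  have [|x _ Ex] := IH a k; first by lia.
  by exists x; rewrite ?EK //; apply: sym => //; rewrite EK.
have notS : ~~ S (a + b).
  apply/negP => /SP[K Kx /(_ Left)/option_add[]] [_ /option_nim[k lk ->] EK].
    have [|x xk Ex] := IH k b; first by lia.
    by move: Kx; rewrite EK Ex => /nim_inj; lia.
  have [|x xk Ex] := IH a k; first by lia.
  by move: Kx; rewrite EK Ex => /nim_inj; lia.
case: (@ex_minnP (fun x => ~~ S x)) => [|c Sc minc]; first by exists (a + b).
exists c; first exact: minc.
have optne p K : is_option p (nim a +g nim b) K -> exists2 x, x != c & K =g nim x.
  by case/optS=> x Sx Kx; exists x => //; apply: contraNneq Sc => <-.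
have optlt k : k < c -> S k by move=> kc; apply: contraTT kc => /minc; rewrite -leqNgt.
split; apply/game_leP; split=> K.
- by case/optne=> x xc ->; apply: lf_nim.
- case/option_nim=> k /optlt/SP[L Lk /(_ Right) Lo] ->.
  by apply: lf_right Lo _; rewrite Lk; apply: le_refl.
- case/option_nim=> k /optlt/SP[L Lk /(_ Left) Lo] ->.
  by apply: lf_left Lo _; rewrite Lk; apply: le_refl.
- by case/optne=> x xc ->; apply: lf_nim; rewrite eq_sym.
Qed.

Lemma nimDnim k : nim k +g nim k =g game_zero.
Proof. by rewrite -{2}neg_nim addgN. Qed.

(** Adding a fixed heap to a large heap leaves a large heap. *)
Lemma nim_sum_shift k m : exists2 c, m <= c + k & nim m +g nim k =g nim c.
Proof.
have [c _ Ec] := nim_sum m k; exists c => //.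
have [d dck Ed] := nim_sum c k; suff <- : d = m by [].
by apply: nim_inj; rewrite -Ed -Ec -addgA nimDnim addg0.
Qed.

(** * Adding a large nim heap *)

Definition eventually (P : nat -> Prop) := exists N, forall m, N <= m -> P m.

Lemma eventually_all (T : Type) (s : seq T) (P : T -> nat -> Prop) :
  (forall x, List.In x s -> eventually (P x)) ->
  eventually (fun m => forall x, List.In x s -> P x m).
Proof.
elim: s => [|x s IH] sP; first by exists 0.
have [|N1 H1] := IH; first by move=> y ys; apply: sP; right.
have [|N2 H2] := sP x; first by left.
exists (maxn N1 N2) => m; rewrite geq_max => /andP[m1 m2] y [<-|ys]; first exact: H2.
exact: H1.
Qed.

Lemma eventually_options p G (P : game -> nat -> Prop) :
  (forall H, is_option p G H -> eventually (P H)) ->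
  eventually (fun m => forall H, is_option p G H -> P H m).
Proof. by case: G => GL GR; apply: eventually_all. Qed.

Definition far_ge0 G := eventually (fun m => game_zero <=g G +g nim m).
Definition far_gf0 G := eventually (fun m => game_zero <|g G +g nim m).

(** Winning by moving the heap to a smaller size stays available for all
    larger heaps; winning by moving in G is governed by the options of G,
    which are stable by induction. *)
Lemma far_stable p G :
  eventually (fun m => wins_first p (G +g nim m)) \/
  eventually (fun m => ~~ wins_first p (G +g nim m)).
Proof.
elim/game_ind_options: G p => G IH p.
have [[k Gk]|noheap] := classic (exists k, ~~ wins_first (opponent p) (G +g nim k)).
  left; exists k.+1 => m km; apply/wins_firstP; exists (G +g nim k) => //.
  by apply/option_addr/option_nim; exists k.
have [[H HG [N HN]]|nooption] := classic (exists2 H, is_option p G H &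
    eventually (fun m => ~~ wins_first (opponent p) (H +g nim m))).
  left; exists N => m /HN Hm; apply/wins_firstP; exists (H +g nim m) => //.
  exact: option_addl.
right; have [|N HN] := @eventually_options p G
    (fun H m => wins_first (opponent p) (H +g nim m)).
  move=> H HG; have [//|ev] := IH p H HG (opponent p).
  by case: nooption; exists H.
exists N => m /HN Hm; apply/wins_firstPn => K /option_add[[H HG ->]|]; first exact: Hm.
case=> _ /option_nim[k km ->] ->; apply: contraT => Gk; case: noheap; exists k.
exact: Gk.
Qed.

Lemma not_far_ge0 G : ~ far_ge0 G -> eventually (fun m => ~~ (game_zero <=g G +g nim m)).
Proof.
case: (far_stable Right G) => -[N HN] G0; first by exists N => m /HN; rewrite le0E negbK.
by case: G0; exists N => m /HN; rewrite le0E.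
Qed.

Lemma far_ge0_equiv G H : G =g H -> far_ge0 G -> far_ge0 H.
Proof. by move=> GH [N HN]; exists N => m /HN; rewrite GH. Qed.

Lemma far_gf0_equiv G H : G =g H -> far_gf0 G -> far_gf0 H.
Proof. by move=> GH [N HN]; exists N => m /HN; rewrite GH. Qed.

Lemma far_ge0_option G H : far_ge0 G -> is_option Right G H -> far_gf0 H.
Proof. by move=> [N HN] HG; exists N => m /HN /le_right; apply; apply: option_addl. Qed.

(** Right may shrink the far star to any heap, so Left must be able to win
    from there. *)
Lemma far_ge0_heap G k : far_ge0 G -> game_zero <|g G +g nim k.
Proof.
move=> [N HN]; apply: (le_right (HN (maxn N k.+1) (leq_maxl _ _))).
by apply/option_addr/option_nim; exists k; rewrite ?leq_max ?ltnSn ?orbT.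
Qed.

Lemma far_gf0_of_heap G k : game_zero <=g G +g nim k -> far_gf0 G.
Proof.
move=> Gk; exists k.+1 => m km; apply: lf_left Gk.
by apply/option_addr/option_nim; exists k.
Qed.

Lemma far_gf0_of_option G H : is_option Left G H -> far_ge0 H -> far_gf0 G.
Proof.
move=> HG [N HN]; exists N => m /HN; apply: lf_left; exact: option_addl.
Qed.

Lemma far_ge0_gf0 G : far_ge0 G -> far_gf0 G.
Proof. by move=> [N /(_ N (leqnn N))]; apply: far_gf0_of_heap. Qed.

(** Left's winning move depends a priori on the size of the heap; by
    stability, one option of G works for all large heaps unless the winning
    moves are in the heap. *)
Lemma far_gf0P G : far_gf0 G ->
  (exists2 H, is_option Left G H & far_ge0 H) \/
  (exists k, game_zero <=g G +g nim k).
Proof.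
move=> [N HN]; apply: NNPP => no; have [|M HM] := @eventually_options Left G
    (fun H m => ~~ (game_zero <=g H +g nim m)).
  by move=> H HG; apply: not_far_ge0 => H0; case: no; left; exists H.
have := HN _ (leq_maxl N M) => /game_lfP[] [K]; last by move/option_zero.
case/option_add=> -[K' K'o ->] K0; last first.
  by case/option_nim: K'o K0 => k _ -> K0; case: no; right; exists k.
by move: K0; apply/negP/HM; rewrite ?leq_maxr.
Qed.

Lemma far_ge0_intro G : (forall H, is_option Right G H -> far_gf0 H) ->
  (forall k, game_zero <|g G +g nim k) -> far_ge0 G.
Proof.
move=> /eventually_options[N HN] Gk; exists N => m /HN Hm; apply/ge0P => K.
case/option_add=> [[H HG ->]|[_ /option_nim[k _ ->] ->]] //; exact: Hm.
Qed.

Lemma far_ge0_nim G k : far_ge0 G -> far_ge0 (G +g nim k).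
Proof.
move=> [N HN]; exists (N + k) => m Nm; have [c mc Ec] := nim_sum_shift k m.
by rewrite -addgA (addgC (nim k)) Ec; apply: HN; lia.
Qed.

Lemma far_gf0_nim G k : far_gf0 G -> far_gf0 (G +g nim k).
Proof.
move=> [N HN]; exists (N + k) => m Nm; have [c mc Ec] := nim_sum_shift k m.
by rewrite -addgA (addgC (nim k)) Ec; apply: HN; lia.
Qed.

(** * Moves on a strip *)

Lemma swap_cat u m v :
  swap (u ++ B :: m ++ W :: v) (size u) (size u + (size m).+1)
  = u ++ W :: m ++ B :: v.
Proof.
have set_cat (x y : stone) a b n :
    n = size a -> set_nth B (a ++ x :: b) n y = a ++ y :: b.
  by move=> ->; elim: a => //= z a ->.
rewrite /swap !nth_cat ltnn subnn ltnNge leq_addr addKn /= nth_cat ltnn subnn /=.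
by rewrite set_cat // -cat_cons catA set_cat -?catA // size_cat.
Qed.

Lemma movesP p s t : t \in moves p s <->
  exists u m v, [/\ s = u ++ B :: m ++ W :: v, colour p \notin m
                  & t = remove_dead (u ++ W :: m ++ B :: v)].
Proof.
have between u m v :
    [seq nth B (u ++ B :: m ++ v) k | k <- iota (size u).+1 (size m)] = m.
  rewrite map_nth_iota ?size_cat /= ?size_cat; last by lia.
  by rewrite -cat_rcons drop_size_cat ?size_rcons // take_size_cat.
have allE x m : all (fun y => y != x) m = (x \notin m).
  by elim: m => //= y m ->; rewrite inE negb_or eq_sym.
split=> [/mapP[[i j]]|[u [m [v [-> m_p ->]]]]].
  rewrite mem_filter /= => /andP[/and4P[/andP[ij js] /eqP si /eqP sj s_p] _ ->].
  have si' := ltn_trans ij js.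
  pose u := take i s; pose m := take (j - i.+1) (drop i.+1 s); pose v := drop j.+1 s.
  have szu : size u = i by rewrite size_takel // ltnW.
  have szm : size m = j - i.+1 by rewrite size_takel // size_drop leq_sub2r // ltnW.
  have def_s : s = u ++ B :: m ++ W :: v.
    rewrite -{1}(cat_take_drop i s) (drop_nth B si') si; congr (_ ++ _ :: _).
    rewrite -{1}(cat_take_drop (j - i.+1) (drop i.+1 s)) drop_drop subnK //.
    by rewrite (drop_nth B js) sj.
  exists u, m, v; split=> //.
    rewrite -allE -[m](between u m (W :: v)) -def_s szu szm all_map.
    by apply: sub_all s_p => k.
  by rewrite -swap_cat -def_s szu szm; congr (remove_dead (swap s i _)); lia.
apply/mapP; exists (size u, size u + (size m).+1); last by rewrite /= swap_cat.
rewrite mem_filter; apply/andP; split; last first.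
  by apply/allpairsP; exists (size u, size u + (size m).+1);
    rewrite !mem_iota size_cat /= size_cat /=; split=> //; lia.
rewrite /legal /=.
have -> : nth B (u ++ B :: m ++ W :: v) (size u) = B.
  by rewrite nth_cat ltnn subnn.
have -> : nth B (u ++ B :: m ++ W :: v) (size u + (size m).+1) = W.
  by rewrite nth_cat ltnNge leq_addr addKn /= nth_cat ltnn subnn.
rewrite size_cat /= size_cat /=; apply/andP; split; first by lia.
have -> : size u + (size m).+1 - (size u).+1 = size m by lia.
by move: m_p; rewrite -allE -{1}[m](between u m (W :: v)) all_map.
Qed.

Lemma option_strip p s K : is_option p (strip_game s) K <->
  exists2 t, t \in moves p s & K = strip_game t.
Proof.
rewrite strip_gameE.
have -> : is_option p (Game [seq strip_game t | t <- moves Left s]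
    [seq strip_game t | t <- moves Right s]) K
  <-> List.In K [seq strip_game t | t <- moves p s] by case: p.
by rewrite In_map; split=> -[t /In_mem]; exists t => //; apply/In_mem.
Qed.

Lemma drop_leading_nseq x n s :
  (s == [::]) || (head x s != x) -> drop_leading x (nseq n x ++ s) = s.
Proof.
rewrite /drop_leading; elim: n => /= [|n IH sx]; last by rewrite eqxx /= IH.
by case: s => //= y s ->.
Qed.

Lemma drop_leadingE x s : exists2 n, s = nseq n x ++ drop_leading x s &
  (drop_leading x s == [::]) || (head x (drop_leading x s) != x).
Proof.
rewrite /drop_leading; elim: s => [|y s [n sE hd]] /=; first by exists 0.
case: eqP => [->|/eqP yx] /=; last by exists 0; rewrite //= ?yx ?orbT.
by exists n.+1; rewrite //= -sE.
Qed.

Lemma strip_last s : is_strip s -> (s == [::]) || (last B s != B).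
Proof. by case/orP=> [->|/andP[_ /eqP->]] //; rewrite orbT. Qed.

Lemma head_rev (x : stone) s : head x (rev s) = last x s.
Proof. by elim/last_ind: s => //= s y _; rewrite rev_rcons last_rcons. Qed.

(** Dead stones are a maximal prefix of W's and a maximal suffix of B's. With
    [remove_deadE], this determines the result of a move without unfolding the
    scanning functions, and shows that trimming commutes with reflection. *)
Lemma remove_dead_eq a b t :
  is_strip t -> remove_dead (nseq a W ++ t ++ nseq b B) = t.
Proof.
move=> t_strip; have [-> | tn0] := eqVneq t [::].
  rewrite /remove_dead drop_leading_nseq; last by case: b.
  by rewrite /= rev_nseq -[nseq b B]cats0 drop_leading_nseq.
rewrite /remove_dead drop_leading_nseq; last first.
  by case: t t_strip tn0 => [|[]].
rewrite rev_cat rev_nseq drop_leading_nseq ?revK //.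
have := strip_last t_strip; rewrite head_rev -!size_eq0 size_rev.
by case: t {tn0 t_strip}.
Qed.

Lemma remove_deadE s : exists a b,
  s = nseq a W ++ remove_dead s ++ nseq b B /\ is_strip (remove_dead s).
Proof.
have [a sE hW] := drop_leadingE W s.
set s1 := drop_leading W s in sE hW.
have [b s1E hB] := drop_leadingE B (rev s1).
rewrite /remove_dead -/s1; set t := drop_leading B (rev s1) in s1E hB *.
have s1E' : s1 = rev t ++ nseq b B by rewrite -[LHS]revK s1E rev_cat rev_nseq.
exists a, b; rewrite -s1E' -sE; split=> //.
rewrite /is_strip; have [//|tn0] := eqVneq (rev t) [::].
apply/andP; split.
  by move: hW; rewrite s1E'; case: (rev t) tn0 => //= -[].
move: hB; rewrite -(revK t) head_rev -size_eq0 size_rev.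
by case: (rev t) tn0 => //= y r _; rewrite revK /=; case: (last y r).
Qed.

Lemma remove_dead_strip s : is_strip (remove_dead s).
Proof. by have [a [b []]] := remove_deadE s. Qed.

Lemma moves_strip p s t : t \in moves p s -> is_strip t.
Proof. by case/movesP=> u [m [v [_ _ ->]]]; apply: remove_dead_strip. Qed.

(** * Mirror images *)

Definition flip x := if x is B then W else B.
Definition mirror s := rev (map flip s).

Lemma flipK : involutive flip. Proof. by case. Qed.

Lemma mirrorK : involutive mirror.
Proof.
by move=> s; rewrite /mirror map_rev revK -map_comp map_id_in // => x _; case: x.
Qed.

Lemma mirror_cat s t : mirror (s ++ t) = mirror t ++ mirror s.
Proof. by rewrite /mirror map_cat rev_cat. Qed.

Lemma mirror_cons x s : mirror (x :: s) = mirror s ++ [:: flip x].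
Proof. by rewrite -cat1s mirror_cat. Qed.

Lemma mirror_nseq n x : mirror (nseq n x) = nseq n (flip x).
Proof. by rewrite /mirror map_nseq rev_nseq. Qed.

Lemma mem_mirror x s : (x \in mirror s) = (flip x \in s).
Proof. by rewrite mem_rev -{1}(flipK x) mem_map //; apply: inv_inj flipK. Qed.

Lemma count_mirror x s : count_mem x (mirror s) = count_mem (flip x) s.
Proof. by rewrite count_rev count_map; apply: eq_count => y; case: x y => -[]. Qed.

Lemma mirror_strip s : is_strip (mirror s) = is_strip s.
Proof.
suff imp r : is_strip r -> is_strip (mirror r).
  by apply/idP/idP => /imp //; rewrite mirrorK.
case/orP=> [/eqP-> //|/andP[]]; rewrite /is_strip /mirror head_rev.
case: r => //= -[] //= r _ /eqP sW; rewrite rev_cons last_rcons eqxx andbT orbC.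
by have := last_map flip r B; rewrite sW /= => ->.
Qed.

Lemma remove_dead_mirror s : remove_dead (mirror s) = mirror (remove_dead s).
Proof.
have [a [b [sE st]]] := remove_deadE s; rewrite {1}sE !mirror_cat !mirror_nseq -catA.
by rewrite remove_dead_eq ?mirror_strip.
Qed.

(** This turns every statement on Left into one on Right. *)
Lemma mirror_moves p s t : t \in moves p s -> mirror t \in moves (opponent p) (mirror s).
Proof.
case/movesP=> u [m [v [-> m_p ->]]]; apply/movesP.
exists (mirror v), (mirror m), (mirror u).
rewrite -remove_dead_mirror !(mirror_cat, mirror_cons) -!catA /=.
by split=> //; rewrite mem_mirror; case: p m_p.
Qed.

Lemma pairs_ind (P : seq stone -> Prop) :
  (forall s, (forall p t, t \in moves p s -> P t) -> P s) -> forall s, P s.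
Proof.
move=> IP s; move: {2}(pairs s).+1 (ltnSn (pairs s)) => n; elim: n s => // n IH s ltn.
by apply: IP => p t /pairs_moves lt; apply: IH; lia.
Qed.

Lemma strip_game_mirror s : strip_game (mirror s) =g -g strip_game s.
Proof.
elim/pairs_ind: s => s IH; apply: equiv_options => p K.
  case/option_strip=> t /mirror_moves; rewrite mirrorK => ts ->.
  exists (-g strip_game (mirror t)); last by rewrite -(IH _ _ ts) mirrorK.
  apply/option_neg; exists (strip_game (mirror t)) => //.
  by apply/option_strip; exists (mirror t).
case/option_neg=> _ /option_strip[t ts ->] ->.
exists (strip_game (mirror t)); last by rewrite (IH _ _ ts).
apply/option_strip; exists (mirror t) => //.
by rewrite -(opponentK p); apply: mirror_moves.
Qed.

(** * How a move changes the excess *)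

Lemma excess_cat s t : (strip_excess (s ++ t) = strip_excess s + strip_excess t)%R.
Proof. by rewrite /strip_excess !count_cat; lia. Qed.

(** Only deleting leading W's lowers the excess. Right moves a W leftwards
    over B's only, at least one, so at most the moved stone becomes dead on
    the left. *)
Lemma right_move_excess s t : is_strip s -> t \in moves Right s ->
  (strip_excess s - 1 <= strip_excess t)%R.
Proof.
move=> s_strip /movesP[u [m [v [sE mW tE]]]].
have [a [b [xE _]]] := remove_deadE (u ++ W :: m ++ B :: v).
rewrite -tE {tE} in xE.
have a1 : a <= 1.
  case: u sE xE => [|x u] sE xE; last first.
    by move: s_strip; rewrite sE; case: x sE xE => // _; case: a.
  case: a xE => [|[|a]] //= []; case: m mW sE => [|y m] //.
  by rewrite inE negb_or => /andP[+ _] _ [yW]; rewrite yW.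
have /(congr1 strip_excess) := xE; rewrite sE !excess_cat /strip_excess /=.
rewrite !count_cat /= !count_nseq /=; lia.
Qed.

Lemma nseqSr n (x : stone) : nseq n.+1 x = rcons (nseq n x) x.
Proof. by rewrite -addn1 nseqD cats1. Qed.

Lemma split_last_black s : B \in s -> exists u k, s = u ++ B :: nseq k W.
Proof.
elim/last_ind: s => // s x IH; rewrite mem_rcons inE.
case: x => /= [_|/IH[u [k ->]]]; first by exists s, 0; rewrite cats1.
by exists u, k.+1; rewrite rcons_cat /= -nseqSr.
Qed.

Lemma strip_split s : is_strip s -> s != [::] ->
  exists u k, s = u ++ B :: nseq k.+1 W.
Proof.
move=> s_strip sn0; have [|u [[|k] sE]] := @split_last_black s; last by exists u, k.
  by case: s s_strip sn0 => [|[]].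
by move: s_strip sn0; rewrite sE /is_strip last_cat /= andbF orbF => ->.
Qed.

(** Left moves the last B to the right end, where it dies. Since another B
    comes first, the moved-over W's stay alive. *)
Lemma left_move_gain s : is_strip s -> 1 < count_mem B s ->
  exists t, [/\ t \in moves Left s, is_strip t & strip_excess t = (strip_excess s + 1)%R].
Proof.
move=> s_strip s2; have sn0 : s != [::] by case: s s2 {s_strip}.
have [u [k sE]] := strip_split s_strip sn0.
exists (u ++ nseq k.+1 W); have t_strip : is_strip (u ++ nseq k.+1 W).
  move: s_strip s2; rewrite sE; case: u {sE} => [|x u]; first by rewrite /= count_nseq.
  by rewrite /is_strip /= !last_cat /= => ->.
split=> //.
  apply/movesP; exists u, (nseq k W), [::]; split.
  - by rewrite sE cats1 -nseqSr.
  - by rewrite mem_nseq andbF.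
  - by rewrite -(remove_dead_eq 0 1 t_strip) /= -!catA.
by rewrite sE !excess_cat /strip_excess /=; lia.
Qed.

(** * Strips with a single black stone *)

(** The strips with at most one black stone; the word B alone is not a strip, so
    that k = 0 stands for the empty one. *)
Definition run k : seq stone := if k is 0 then [::] else B :: nseq k W.

Lemma run_strip k : is_strip (run k).
Proof. by case: k => // k; rewrite /run nseqSr /is_strip /= last_rcons. Qed.

Lemma single_black_run s : is_strip s -> count_mem B s <= 1 -> exists k, s = run k.
Proof.
move=> s_strip s1; have [->|sn0] := eqVneq s [::]; first by exists 0.
have [[|x u] [k sE]] := strip_split s_strip sn0; first by exists k.+1.
move: s_strip s1; rewrite sE; case: x {sE sn0} => //=; rewrite count_cat /=; lia.
Qed.

Lemma run_left_end k : is_option Left (strip_game (run k.+1)) game_zero.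
Proof.
apply/option_strip; exists [::] => //; apply/movesP.
exists [::], (nseq k W), [::]; split; rewrite ?mem_nseq ?andbF //=.
  by rewrite cats1 -nseqSr.
by rewrite -[LHS](@remove_dead_eq k.+1 1 [::]).
Qed.

Lemma run_left_star k : is_option Left (strip_game (run k.+2)) (strip_game (run 1)).
Proof.
apply/option_strip; exists (run 1) => //; apply/movesP.
exists [::], (nseq k W), [:: W]; split; rewrite ?mem_nseq ?andbF //=.
  by rewrite -cat_rcons -nseqSr cats1 -nseqSr.
by rewrite -[LHS](@remove_dead_eq k.+1 0 (run 1)).
Qed.

Lemma run_right k K : is_option Right (strip_game (run k.+1)) K -> K = strip_game (run k).
Proof.
case/option_strip=> t /movesP[u [m [v [/= sE mW tE]]]] ->; congr strip_game.
have /(congr1 (count_mem B)) := sE; rewrite count_cat /= count_nseq /= => u0.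
case: u sE u0 tE => [|[] u] //=; last by lia.
move=> [sE] _ tE.
have m0 : m = [::].
  case: m mW sE {tE} => // y m; rewrite inE negb_or eq_sym => /andP[yW _] sE.
  have : y \in nseq k.+1 W by rewrite /= sE mem_head.
  by rewrite mem_nseq (negPf yW) andbF.
rewrite tE m0 /=; move: sE; rewrite m0 /= => -[<-]; case: k => [|k] //.
by rewrite -[RHS](@remove_dead_eq 1 0 _ (run_strip k.+1)) /= cats0.
Qed.

(** For k > 0 the strip B W^k behaves like k - 1 copies of up, with a star when
    k is odd. Right's single move is to shorten the strip, which Left answers by
    ending it or, if the nimber is a star, by removing that star. *)
Lemma run_ge_nim k : nim (odd k) <=g strip_game (run k).
Proof.
elim: k => [|k IH] //; apply/game_leP; split=> [K|K /run_right->].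
  case/option_nim=> j; case: (odd _) => //; case: j => // _ ->.
  exact: lf_left (run_left_end k) _.
case: k IH => [|k] IH; first exact: (@lf_nim 1 0).
move: IH; rewrite !oddS negbK; case: (odd k) => IH.
  by apply: lf_right IH; apply/option_nim; exists 0.
exact: lf_left (run_left_end k) _.
Qed.

(** The strip B W^k with k > 1 is at least as good for Left as up, with or
    without a star, and up plus a nim heap is a first-player win for Left. *)
Lemma run_gf_nim k j : 1 < k -> game_zero <|g strip_game (run k) +g nim j.
Proof.
case: k => [|[|k]] // _; case: j => [|[|j]].
- by rewrite addg0; apply: lf_left (run_left_end _) _.
- apply: lf_left (option_addl _ (run_left_star k)) _.
  by rewrite -(nimDnim 1); apply: le_addr (run_ge_nim 1).
- (* The heap has at least two stones, so Left can bring it to size 0 or 1,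
     whichever is the nimber that bounds the strip from below. *)
  apply: (lf_left (K := strip_game (run k.+2) +g nim (odd k.+2))).
    by apply/option_addr/option_nim; exists (odd k.+2 : nat) => //; case: odd.
  by rewrite -(nimDnim (odd k.+2)); apply: le_addr (run_ge_nim _).
Qed.

(** * Positions *)

Lemma position_cons s g : position_game (s :: g) = strip_game s +g position_game g.
Proof. by []. Qed.

Lemma position_cat g h :
  position_game (g ++ h) =g position_game g +g position_game h.
Proof.
elim: g => [|s g IH]; first by rewrite -[position_game [::]]/game_zero add0g.
by rewrite cat_cons !position_cons IH addgA.
Qed.

Lemma position_excess_cat g h : (excess (g ++ h) = excess g + excess h)%R.
Proof. exact: big_cat. Qed.

Lemma excess_cons s g : (excess (s :: g) = strip_excess s + excess g)%R.
Proof. exact: big_cons. Qed.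

Lemma excess_nil : (excess [::] = 0)%R. Proof. exact: big_nil. Qed.

Lemma position_right_option g K : all is_strip g ->
  is_option Right (position_game g) K ->
  exists h, [/\ all is_strip h, K = position_game h & (excess g - 1 <= excess h)%R].
Proof.
elim: g K => [|s g IH] K /=; first by [].
case/andP=> s_strip g_strip /option_add[] [K' K'o ->]; last first.
  have [h [h_strip -> ex]] := IH _ g_strip K'o; exists (s :: h).
  by rewrite /= s_strip h_strip !excess_cons; split=> //; lia.
have [t ts ->] := proj1 (option_strip _ _ _) K'o; exists (t :: g).
rewrite /= (moves_strip ts) g_strip !excess_cons; split=> //.
by have := right_move_excess s_strip ts; lia.
Qed.

Lemma position_left_gain g : all is_strip g -> ~~ all (fun s => count_mem B s <= 1) g ->
  exists h, [/\ all is_strip h, is_option Left (position_game g) (position_game h)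
              & (excess h = excess g + 1)%R].
Proof.
elim: g => //= s g IH /andP[s_strip g_strip].
rewrite negb_and -ltnNge; case: (ltnP 1 (count_mem B s)) => /= [s2 _|_ /(IH g_strip)].
  have [t [ts t_strip ex]] := left_move_gain s_strip s2; exists (t :: g).
  rewrite /= t_strip g_strip !excess_cons ex; split=> //; last by lia.
  by apply/option_addl/option_strip; exists t.
move=> [h [h_strip ho ex]]; exists (s :: h).
rewrite /= s_strip h_strip !excess_cons ex; split=> //; last by lia.
exact: option_addr.
Qed.

Lemma runs_excess g : all is_strip g -> all (fun s => count_mem B s <= 1) g ->
  (0 <= excess g)%R.
Proof.
elim: g => [|s g IH] /=; first by rewrite excess_nil.
case/andP=> s_strip g_strip /andP[s1 g1]; rewrite excess_cons.
have [k ->] := single_black_run s_strip s1; have := IH g_strip g1.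
by rewrite /strip_excess; case: k => /= [|k]; rewrite ?count_nseq /=; lia.
Qed.

Lemma runs_ge_nim g : all is_strip g -> all (fun s => count_mem B s <= 1) g ->
  exists c, nim c <=g position_game g.
Proof.
elim: g => [|s g IH] /=; first by exists 0; apply: le_refl.
case/andP=> s_strip g_strip /andP[s1 g1].
have [k ->] := single_black_run s_strip s1; have [c cg] := IH g_strip g1.
have [d _ Ed] := nim_sum (odd k) c; exists d; rewrite -Ed position_cons.
exact: le_trans (le_addr _ (run_ge_nim k)) (le_addl _ cg).
Qed.

Lemma runs_gf_nim g j : all is_strip g -> all (fun s => count_mem B s <= 1) g ->
  (1 <= excess g)%R -> game_zero <|g position_game g +g nim j.
Proof.
elim: g j => [|s g IH] j /=; first by rewrite excess_nil.
case/andP=> s_strip g_strip /andP[s1 g1]; rewrite excess_cons position_cons.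
have [k ->] := single_black_run s_strip s1; case: (ltnP 1 k) => k1.
  have [c cg] := runs_ge_nim g_strip g1; have [d _ Ed] := nim_sum c j.
  move=> _; apply: lf_le_trans (run_gf_nim d k1) _; rewrite -Ed -addgA.
  exact/le_addl/le_addr.
have -> : strip_excess (run k) = 0%R by case: k k1 => [|[]].
rewrite add0r => ex; have [d _ Ed] := nim_sum (odd k) j.
apply: lf_le_trans (IH d g_strip g1 ex) _; rewrite -Ed addgCA addgA.
exact/le_addr/le_addr/run_ge_nim.
Qed.

(** * Positions of non-negative excess *)

(** When every strip has at most one black stone, the excess is the sum of the
    terms k - 1 >= 0 over the nonempty strips B W^k, and the bounds of
    [run_ge_nim] and [run_gf_nim] add up. *)
Lemma position_dichotomy g : all is_strip g ->
  (exists h, [/\ all is_strip h, is_option Left (position_game g) (position_game h)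
              & (excess h = excess g + 1)%R]) \/
  [/\ (0 <= excess g)%R, exists c, nim c <=g position_game g &
      (1 <= excess g)%R -> forall j, game_zero <|g position_game g +g nim j].
Proof.
move=> g_strip; case: (boolP (all (fun s => count_mem B s <= 1) g)) => [g1|].
  right; split; [exact: runs_excess|exact: runs_ge_nim|].
  by move=> ex j; apply: runs_gf_nim.
by move/(position_left_gain g_strip); left.
Qed.

(** A Right move costs at most one unit, so the claim for a player moving second
    follows from the other one, one unit lower; Left, moving first, gains the
    unit back or finds only strips with a single black stone. *)
Lemma ahead_nim g : all is_strip g ->
  ((1 <= excess g)%R -> forall j, game_zero <|g position_game g +g nim j) /\
  ((2%:Z <= excess g)%R -> forall j, game_zero <=g position_game g +g nim j).
Proof.
move: {2}(game_size _).+1 (ltnSn (game_size (position_game g))) => n.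
elim: n g => // n IH g ltn g_strip.
have one j : (1 <= excess g)%R -> game_zero <|g position_game g +g nim j.
  move=> ex; case: (position_dichotomy g_strip) => [[h [h_strip ho hex]]|[_ _ ->]] //.
  apply: lf_left (option_addl _ ho) _.
  by apply: (proj2 (IH h _ h_strip)); [have := option_size ho; lia|lia].
split=> [ex j|ex j]; first exact: one.
apply/ge0P => K /option_add[[K' K'o ->]|[_ /option_nim[k _ ->] ->]]; last first.
  by apply: one; lia.
have [h [h_strip Kh hex]] := position_right_option g_strip K'o; rewrite Kh in K'o *.
by apply: (proj1 (IH h _ h_strip)); [have := option_size K'o; lia|lia].
Qed.

(** The same alternation as in [ahead_nim], but against a far star one unit
    less is needed: Left may shrink the far star to cancel whatever nimber
    remains. *)
Lemma ahead_far g : all is_strip g ->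
  ((0 <= excess g)%R -> far_gf0 (position_game g)) /\
  ((1 <= excess g)%R -> far_ge0 (position_game g)).
Proof.
move: {2}(game_size _).+1 (ltnSn (game_size (position_game g))) => n.
elim: n g => // n IH g ltn g_strip.
have zero : (0 <= excess g)%R -> far_gf0 (position_game g).
  move=> ex; case: (position_dichotomy g_strip) => [[h [h_strip ho hex]]|[_ [c cg] _]].
    apply: (far_gf0_of_option ho).
    by apply: (proj2 (IH h _ h_strip)); [have := option_size ho; lia|lia].
  apply: (@far_gf0_of_heap _ c); rewrite -(nimDnim c); exact: le_addr.
split=> // ex; apply: far_ge0_intro => [K Ko|k]; last exact: (proj1 (ahead_nim g_strip)).
have [h [h_strip Kh hex]] := position_right_option g_strip Ko; rewrite Kh in Ko *.
by apply: (proj1 (IH h _ h_strip)); [have := option_size Ko; lia|lia].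
Qed.

(** The situation after Right has shrunk the far star to a heap k. The game X,
    non-negative with a far star, counts as one unit, so X together with a
    position of excess at least 0, respectively 1, behaves like a position
    one, respectively two, units ahead in [ahead_nim]. *)
Lemma position_add_nim g X : all is_strip g ->
  [/\ (0 <= excess g)%R -> far_ge0 X ->
        forall k, game_zero <|g position_game g +g X +g nim k,
      (1 <= excess g)%R -> far_gf0 X ->
        forall k, game_zero <|g position_game g +g X +g nim k
    & (1 <= excess g)%R -> far_ge0 X ->
        forall k, game_zero <=g position_game g +g X +g nim k].
Proof.
move: {2}(_ + _).+1 (ltnSn (game_size (position_game g) + game_size X)) => n.
elim: n g X => // n IH g X ltn g_strip.
have T k : (0 <= excess g)%R -> far_ge0 X -> game_zero <|g position_game g +g X +g nim k.
  move=> ex X0; case: (position_dichotomy g_strip) => [[h [h_strip ho hex]]|[_ [c cg] _]].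
    apply: lf_left (option_addl _ (option_addl _ ho)) _.
    by case: (IH h X _ h_strip) => [|_ _ -> //]; [have := option_size ho; lia|lia].
  have [d _ Ed] := nim_sum c k; apply: lf_le_trans (far_ge0_heap d X0) _.
  by rewrite -Ed addgCA addgA; apply/le_addr/le_addr.
have U k : (1 <= excess g)%R -> far_gf0 X -> game_zero <|g position_game g +g X +g nim k.
  move=> ex /far_gf0P[[Y Yo Y0]|[j Xj]].
    apply: lf_left (option_addl _ (option_addr _ Yo)) _.
    by case: (IH g Y _ g_strip) => [|_ _ -> //]; have := option_size Yo; lia.
  (* d is k + j, so that the game is the sum of X + *j, which Left wins moving
     second, and g + *d, which he wins moving first. *)
  have [d _ Ed] := nim_sum k j; have := proj1 (ahead_nim g_strip) ex d.
  move/(addg_ge0_gf0 Xj); rewrite -Ed; congr (is_true _).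
  have -> : X +g nim j +g (position_game g +g (nim k +g nim j))
     =g position_game g +g X +g nim k +g (nim j +g nim j).
    rewrite (addgC (nim k)) !addgA (addgAC _ (nim j) (nim k)).
    by rewrite (addgAC X) (addgC X) (addgAC _ _ (nim k)).
  by rewrite nimDnim addg0.
split=> [ex X0 k|ex X0 k|ex X0 k]; [exact: T|exact: U|].
apply/ge0P => K /option_add[[K' K'o ->]|[_ /option_nim[j _ ->] ->]]; last first.
  by apply: T X0; lia.
case/option_add: K'o => -[L Lo ->].
  have [h [h_strip Kh hex]] := position_right_option g_strip Lo; rewrite Kh in Lo *.
  by case: (IH h X _ h_strip) => [|-> //]; [have := option_size Lo; lia|lia].
case: (IH g L _ g_strip) => [|_ -> //]; first by have := option_size Lo; lia.
exact: far_ge0_option Lo.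
Qed.

(** Left follows his strategy for X, restores the excess when a Right move makes
    it negative, and relies on [position_add_nim] when Right gives up the far
    star. If the strategy for X shrinks the far star to a definite heap, adding
    this heap twice splits the game into X with the heap, which is non-negative,
    and g with the heap and a far star, which is won by [ahead_far]. *)
Lemma position_add_far g X : all is_strip g -> (0 <= excess g)%R ->
  (far_gf0 X -> far_gf0 (position_game g +g X)) /\
  (far_ge0 X -> far_ge0 (position_game g +g X)).
Proof.
move: {2}(_ + _).+1 (ltnSn (game_size (position_game g) + game_size X)) => n.
elim: n g X => // n IH g X ltn g_strip ex.
split=> [/far_gf0P[[Y Yo Y0]|[j Xj]]|X0].
- apply: (far_gf0_of_option (option_addr _ Yo)).
  by apply: (proj2 (IH g Y _ g_strip ex)) => //; have := option_size Yo; lia.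
- (* Left wins X + *j moving second and g + *j, with a far star, moving first;
     the two heaps j cancel. *)
  have [N HN] := far_gf0_nim j (proj1 (ahead_far g_strip) ex).
  exists N => m /HN /(addg_ge0_gf0 Xj); congr (is_true _).
  have -> : X +g nim j +g (position_game g +g nim j +g nim m)
     =g position_game g +g X +g nim m +g (nim j +g nim j).
    rewrite addgA (addgACA X) (addgC X) -(addgA _ _ (nim m)) (addgC _ (nim m)).
    by rewrite addgA.
  by rewrite nimDnim addg0.
apply: far_ge0_intro => [K|k]; last by case: (position_add_nim X g_strip) => ->.
case/option_add=> [[K' K'o ->]|[Y Yo ->]]; last first.
  apply: (proj1 (IH g Y _ g_strip ex)); last exact: far_ge0_option Yo.
  by have := option_size Yo; lia.
have [h [h_strip Kh hex]] := position_right_option g_strip K'o; rewrite Kh in K'o *.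
have lt := option_size K'o.
have [h0|h0] := boolP (0 <= excess h)%R.
  by apply: (proj1 (IH h X _ h_strip h0)); [lia|apply: far_ge0_gf0].
case: (position_dichotomy h_strip) => [[l [l_strip lo lex]]|[]]; last by lia.
apply: (far_gf0_of_option (option_addl _ lo)).
by apply: (proj2 (IH l X _ l_strip _)) => //; [have := option_size lo|]; lia.
Qed.

(** * Mirror images of positions *)

Lemma excess_mirror g : (excess (map mirror g) = - excess g)%R.
Proof.
elim: g => [|s g IH]; first by rewrite excess_nil.
by rewrite /= !excess_cons IH /strip_excess !count_mirror /=; lia.
Qed.

Lemma position_mirror g : position_game (map mirror g) =g -g position_game g.
Proof.
elim: g => [|s g IH]; first by [].
by rewrite map_cons !position_cons negD strip_game_mirror IH.
Qed.

Lemma all_strip_mirror g : all is_strip (map mirror g) = all is_strip g.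
Proof. by rewrite all_map; apply: eq_all => s; apply: mirror_strip. Qed.

#[local] Arguments game_add : simpl never.

(** * Outcomes and the far star *)

Lemma eventually_and (P Q : nat -> Prop) :
  eventually P -> eventually Q -> eventually (fun m => P m /\ Q m).
Proof.
move=> [N HN] [M HM]; exists (maxn N M) => m; rewrite geq_max => /andP[Nm Mm].
by split; [apply: HN|apply: HM].
Qed.

Lemma gf0_neg G : (game_zero <|g -g G) = wins_first Right G.
Proof. by rewrite -[game_zero]/(-g game_zero) lf_neg -not_le le0E negbK. Qed.

Lemma ge0_neg G : (game_zero <=g -g G) = ~~ wins_first Left G.
Proof. by rewrite -[game_zero]/(-g game_zero) le_neg -not_lf lf0E. Qed.

Lemma neg_add_nim G m : -g (G +g nim m) = -g G +g nim m.
Proof. by rewrite negD neg_nim. Qed.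

(** Outcomes with a far star in terms of the two one-sided conditions only;
    Right's side is obtained by negation. *)
Definition far_test (G : game) (o : outcome_class) : Prop :=
  match o with
  | OutL => far_gf0 G /\ far_ge0 G
  | OutR => far_gf0 (-g G) /\ far_ge0 (-g G)
  | OutN => far_gf0 G /\ far_gf0 (-g G)
  | OutP => far_ge0 G /\ far_ge0 (-g G)
  end.

Lemma far_test_outcome G o : far_test G o -> far_outcome G o.
Proof.
case: o => -[/eventually_and /[apply] [[N HN]]]; exists N => m /HN;
  rewrite -?neg_add_nim ?gf0_neg ?ge0_neg ?lf0E ?le0E /game_outcome => -[];
  by do 2 case: (wins_first _ _).
Qed.

Lemma far_test_exists G : exists o, far_test G o.
Proof.
have [L0|L0] := far_stable Left G; have [R0|R0] := far_stable Right G.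
- exists OutN; case: L0 R0 => [N HN] [M HM]; split; [exists N|exists M] => m;
  by rewrite -?neg_add_nim ?gf0_neg ?lf0E; auto.
- exists OutL; case: L0 R0 => [N HN] [M HM]; split; [exists N|exists M] => m;
  by rewrite -?neg_add_nim ?lf0E ?le0E; auto.
- exists OutR; case: L0 R0 => [N HN] [M HM]; split; [exists M|exists N] => m;
  by rewrite -?neg_add_nim ?gf0_neg ?ge0_neg; auto.
- exists OutP; case: L0 R0 => [N HN] [M HM]; split; [exists M|exists N] => m;
  by rewrite -?neg_add_nim ?ge0_neg ?le0E; auto.
Qed.

Lemma far_outcome_unique G o o' : far_outcome G o -> far_outcome G o' -> o = o'.
Proof.
by move=> [N HN] [M HM]; rewrite -(HN (maxn N M)) ?leq_maxl // HM ?leq_maxr.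
Qed.

Lemma far_outcome_test G o : far_outcome G o -> far_test G o.
Proof.
have [o' Go'] := far_test_exists G => Go.
by rewrite (far_outcome_unique Go (far_test_outcome Go')).
Qed.

Lemma far_ge0_gf0_neg G : far_ge0 G -> far_gf0 (-g G) -> False.
Proof.
move=> /eventually_and /[apply] [[N /(_ N (leqnn N))]].
by rewrite -neg_add_nim gf0_neg le0E => -[/negP].
Qed.

Lemma far_eq_ge0 G H X : far_eq G H -> far_ge0 (G +g X) -> far_ge0 (H +g X).
Proof.
move=> /(_ X)[o [/far_outcome_test Go /far_outcome_test Ho]] G0.
case: o Go Ho => -[? ?] [? ?] //.
all: by case: (far_ge0_gf0_neg G0).
Qed.

Lemma far_eq_le0 G H X :
  far_eq G H -> far_ge0 (-g (G +g X)) -> far_ge0 (-g (H +g X)).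
Proof.
move=> /(_ X)[o [/far_outcome_test Go /far_outcome_test Ho]] G0.
case: o Go Ho => -[? ?] [? ?] //.
all: by case: (far_ge0_gf0_neg G0); rewrite negK.
Qed.

(** Only implications from G to H are required, because each outcome is
    characterized by two positive conditions. *)
Lemma far_eqW G H :
  (forall X, far_gf0 (G +g X) -> far_gf0 (H +g X)) ->
  (forall X, far_ge0 (G +g X) -> far_ge0 (H +g X)) ->
  (forall X, far_gf0 (-g (G +g X)) -> far_gf0 (-g (H +g X))) ->
  (forall X, far_ge0 (-g (G +g X)) -> far_ge0 (-g (H +g X))) -> far_eq G H.
Proof.
move=> gf ge lf le X; have [o Go] := far_test_exists (G +g X); exists o.
split; apply: far_test_outcome => //.
by case: o Go => -[] /=; auto.
Qed.

Lemma far_eq_sym G H : far_eq G H -> far_eq H G.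
Proof. by move=> GH X; have [o []] := GH X; exists o. Qed.

Lemma far_eq_trans G H K : far_eq G H -> far_eq H K -> far_eq G K.
Proof.
move=> GH HK X; have [o [Go Ho]] := GH X; have [o' [Ho' Ko']] := HK X.
by exists o; rewrite {2}(far_outcome_unique Ho Ho').
Qed.

(** * Multiples of up *)

Local Open Scope ring_scope.

Lemma neg_copies k G : -g (copies k G) = copies k (-g G).
Proof. by elim: k => //= k <-; rewrite negD. Qed.

Lemma int_times_upN n : int_times_up (- n) = -g int_times_up n.
Proof.
case: n => [[|k]|k] //.
- by rewrite -[int_times_up k.+1]/(copies k.+1 up) neg_copies.
- by rewrite -[int_times_up (Negz k)]/(copies k.+1 down) neg_copies negK.
Qed.

#[export] Instance copies_proper k : Proper (game_equiv ==> game_equiv) (copies k).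
Proof. by move=> G H GH; elim: k => //= k IH; apply: game_add_proper. Qed.

(** Up is the strip BWW and down is BBW, so multiples of up are positions and
    the results on positions apply to them. *)
Definition up_strips (n : int) : seq (seq stone) :=
  match n with
  | Posz k => nseq k [:: B; W; W]
  | Negz k => nseq k.+1 [:: B; B; W]
  end.

Lemma up_strips_strip n : all is_strip (up_strips n).
Proof. by case: n => k; rewrite all_nseq orbT. Qed.

Lemma up_strips_excess n : excess (up_strips n) = n.
Proof.
by case: n => k; rewrite /excess big_nseq /strip_excess /=;
  elim: k => //= k IH; rewrite ?IH /=; lia.
Qed.

Lemma strip_game_up : strip_game [:: B; W; W] =g up.
Proof. by split; vm_compute. Qed.

Lemma strip_game_down : strip_game [:: B; B; W] =g down.
Proof. by split; vm_compute. Qed.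

Lemma up_strips_game n : position_game (up_strips n) =g int_times_up n.
Proof.
have nseqE k s : position_game (nseq k s) = copies k (strip_game s).
  by elim: k => // k IH; rewrite /= position_cons IH.
by case: n => k; rewrite nseqE ?strip_game_up ?strip_game_down.
Qed.

Lemma int_times_upS n : int_times_up (n + 1) =g up +g int_times_up n.
Proof.
have upD : up +g down =g game_zero by apply: addgN.
case: n => [k|[|k]]; first by rewrite addrC.
  by rewrite /= addgA upD add0g.
have -> : Negz k.+1 + 1 = Negz k by lia.
by rewrite [int_times_up (Negz k.+1)]/= (addgA up) upD add0g.
Qed.

Lemma int_times_upD m n :
  int_times_up (m + n) =g int_times_up m +g int_times_up n.
Proof.
have pos k i : int_times_up (Posz k + i) =g int_times_up k +g int_times_up i.
  elim: k => [|k IH]; first by rewrite add0r -[int_times_up 0]/game_zero add0g.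
  have -> : Posz k.+1 + i = (Posz k + i) + 1 by lia.
  by rewrite int_times_upS IH addgA.
case: m => [k|k]; first exact: pos.
rewrite -[Negz k]opprK -[- Negz k]/(Posz k.+1) -[- _ + n]opprK int_times_upN.
rewrite opprD opprK pos negD -!int_times_upN opprK.
reflexivity.
Qed.

Lemma up_gf_nim n k : 1 <= n -> game_zero <|g int_times_up n +g nim k.
Proof.
rewrite -up_strips_game => n1; apply: (proj1 (ahead_nim (up_strips_strip n))).
by rewrite up_strips_excess.
Qed.

Lemma up_ge_nim n k : 2%:Z <= n -> game_zero <=g int_times_up n +g nim k.
Proof.
rewrite -up_strips_game => n1; apply: (proj2 (ahead_nim (up_strips_strip n))).
by rewrite up_strips_excess.
Qed.

Lemma far_gf0_up n : 0 <= n -> far_gf0 (int_times_up n).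
Proof.
move=> n0; apply: far_gf0_equiv (up_strips_game n) _.
by apply: (proj1 (ahead_far (up_strips_strip n))); rewrite up_strips_excess.
Qed.

Lemma far_ge0_up n : 1 <= n -> far_ge0 (int_times_up n).
Proof.
move=> n0; apply: far_ge0_equiv (up_strips_game n) _.
by apply: (proj2 (ahead_far (up_strips_strip n))); rewrite up_strips_excess.
Qed.

Lemma up_ge0 : game_zero <=g up. Proof. by []. Qed.

Lemma option_copies p k G K : is_option p (copies k G) K ->
  exists2 G', is_option p G G' & exists2 j, k = j.+1 & K =g G' +g copies j G.
Proof.
elim: k K => [|k IH] K; first by move/option_zero.
case/option_add=> -[G' G'o ->]; first by exists G' => //; exists k.
have [G2 G2o [j -> E]] := IH _ G'o.
by exists G2 => //; exists j.+1 => //; rewrite E addgCA.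
Qed.

(** Right's move in up loses one copy and leaves a star, his move in down
    removes one copy of down. The latter is better for Left by the positive
    game up + up + star, so the first bound covers both. *)
Lemma int_times_up_right n K : is_option Right (int_times_up n) K ->
  int_times_up (n - 1) +g nim 1 <=g K.
Proof.
case: n => k /option_copies[G' G'o [j Ek ->]].
  case: G'o => // <-; rewrite Ek -[X in X - 1]/(j.+1%:Z).
  have -> : j.+1%:Z - 1 = j by lia.
  by rewrite addgC; apply: le_refl.
case: G'o => // <-; rewrite add0g; case: Ek => ->.
have -> : copies j down = int_times_up (Negz j + 1).
  case: j => // j; rewrite -[copies _ _]/(int_times_up (Negz j)).
  by congr int_times_up; lia.
have -> : Negz j + 1 = (Negz j - 1) + 2 by lia.
rewrite (int_times_upD _ 2); apply: le_addl.
have := up_ge_nim 1 (isT : 2%:Z <= 2); move/(le_addr (nim 1)).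
by rewrite add0g -addgA nimDnim addg0.
Qed.

(** * Integers *)

Lemma int_gameN n : int_game (- n) = -g int_game n.
Proof. by case: n => [[|k]|k] //=; rewrite negK. Qed.

Lemma int_option_left n K : is_option Left (int_game n) K ->
  0 < n /\ K = int_game (n - 1).
Proof.
case: n => [[|k]|k] // [] // <-; split=> //.
by rewrite (_ : k.+1%:Z - 1 = k) //; lia.
Qed.

Lemma int_option_right n K : is_option Right (int_game n) K ->
  n < 0 /\ K = int_game (n + 1).
Proof.
rewrite -[int_game n]negK -int_gameN => /option_neg[H /int_option_left[n0 ->] ->].
by rewrite -int_gameN; split; [|congr int_game]; lia.
Qed.

Lemma int_left n : 0 < n -> is_option Left (int_game n) (int_game (n - 1)).
Proof.
case: n => [[|k]|] // _; left.
by have -> : k.+1%:Z - 1 = k by lia.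
Qed.

Lemma int_right n : n < 0 -> is_option Right (int_game n) (int_game (n + 1)).
Proof.
move=> n0; rewrite -[int_game n]negK -int_gameN; apply/option_neg.
exists (int_game (- n - 1)); first by apply: int_left; lia.
by rewrite -int_gameN; congr int_game; lia.
Qed.

Lemma le_int a b : a <= b -> int_game a <=g int_game b.
Proof.
move: {2}(absz a + absz b).+1 (ltnSn (absz a + absz b)) => n.
elim: n a b => // n IH a b ltn ab; apply/game_leP; split=> K.
  case/int_option_left=> a0 ->; apply: (lf_left (K := int_game (b - 1))).
    by apply: int_left; lia.
  by apply: IH; lia.
case/int_option_right=> b0 ->; apply: (lf_right (K := int_game (a + 1))).
  by apply: int_right; lia.
by apply: IH; lia.
Qed.

Lemma lf_int a b : (int_game a <|g int_game b) = (a < b).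
Proof.
apply/idP/idP => [|ab]; first by apply: contraTT => ?; rewrite not_lf; apply: le_int; lia.
have [b0|b0] := boolP (0 < b).
  by apply: lf_left (int_left b0) _; apply: le_int; lia.
by apply: lf_right (int_right _) _; [lia|apply: le_int; lia].
Qed.

Lemma int_game_inj a b : int_game a =g int_game b -> a = b.
Proof. by case; rewrite -!not_lf !lf_int; lia. Qed.

Definition nonintegral G := forall n, ~ G =g int_game n.

(** The only other way for Left to win G - n is to move in -n, when n < 0, to
    G - (n + 1) >= 0. As G is not n + 1, the same question arises for n + 1,
    and this ends at 0. *)
Lemma lf_int_option n G : nonintegral G -> int_game n <|g G ->
  exists2 K, is_option Left G K & int_game n <=g K.
Proof.
move=> Gni; move: {2}(absz n).+1 (ltnSn (absz n)) => k.
elim: k n => // k IH n ltn /game_lfP[] [K Ko nK]; first by exists K.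
have [n0 EK] := int_option_right Ko; rewrite EK in nK.
have [|//|L Lo nL] := IH (n + 1); first by lia.
  by rewrite -not_le; apply/negP => Gn; apply: (Gni (n + 1)).
by exists L => //; apply: le_trans nL; apply: le_int; lia.
Qed.

(** * The product with up *)

Lemma integer_value_int G n : G =g int_game n -> integer_value G = Some n.
Proof.
move=> Gn; rewrite /integer_value;
  case: excluded_middle_informative => [ex|no]; last first.
  by case: no; exists n; apply/game_eqP.
congr Some; apply: int_game_inj; transitivity G => //.
by symmetry; apply/game_eqP; apply: (epsilon_spec _ _ ex).
Qed.

Lemma integer_value_none G : nonintegral G -> integer_value G = None.
Proof.
move=> Gni; rewrite /integer_value; case: excluded_middle_informative => // ex.
by exfalso; have [n /game_eqP/Gni] := ex.
Qed.

Lemma times_up_int G n : G =g int_game n -> times_up G = int_times_up n.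
Proof. by case: G => GL GR /integer_value_int /= ->. Qed.

Definition two_ahead_star p := if p is Left then double_up_star else double_down_star.

Lemma option_times_up p G K : nonintegral G -> is_option p (times_up G) K <->
  exists2 H, is_option p G H & K = times_up H +g two_ahead_star p.
Proof. by case: G => GL GR /integer_value_none /= ->; case: p; rewrite /= In_map. Qed.

Lemma integral_dec G : (exists n, G =g int_game n) \/ nonintegral G.
Proof.
have [[n Gn]|no] := classic (exists n, G =g int_game n); first by left; exists n.
by right=> n Gn; apply: no; exists n.
Qed.

Lemma times_up_neg G : times_up (-g G) = -g (times_up G).
Proof.
elim/game_ind_options: G => G IH.
case: (integral_dec G) => [[n Gn]|Gni].
  by rewrite (times_up_int Gn) -int_times_upN; apply: times_up_int; rewrite Gn int_gameN.
have Nni : nonintegral (-g G).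
  by move=> n En; apply: (Gni (- n)); rewrite int_gameN -En negK.
have := integer_value_none Gni; have := integer_value_none Nni.
case: G {Gni Nni} IH => GL GR IH /= -> ->.
rewrite /= -!map_comp; congr Game; apply: eq_map_In => H Ho /=.
- by rewrite (IH Right H Ho) negD.
- by rewrite (IH Left H Ho) negD.
Qed.

Lemma double_up_starE : double_up_star =g int_times_up 2 +g nim 1.
Proof. by rewrite /double_up_star /= addg0. Qed.

Lemma double_down_starE : double_down_star =g int_times_up (- 2%:Z) +g nim 1.
Proof. by rewrite /double_down_star /= addg0. Qed.

(** The first two claims compare G with n through G.up - n.up with a far star;
    they determine each other along the options of G because an option of G.up
    comes with two copies of up or down. Moves in the multiple of up or in the
    heap are answered by a Left move in G, after which two more copies of up
    are available and a definite heap, no longer a far star, has to be faced: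
    this is the role of the last two claims. *)
Lemma times_up_far G n :
  [/\ int_game n <=g G -> far_ge0 (times_up G +g int_times_up (1 - n)),
      int_game n <|g G -> far_gf0 (times_up G +g int_times_up (- 1 - n)),
      int_game n <=g G ->
        forall k, game_zero <=g times_up G +g int_times_up (2 - n) +g nim k
    & int_game n <|g G ->
        forall k, game_zero <|g times_up G +g int_times_up (- n) +g nim k].
Proof.
elim/game_ind_options: G n => G IH n.
case: (integral_dec G) => [[a Ga]|Gni].
  have leE : (int_game n <=g G) = (n <= a) by rewrite Ga -not_lf lf_int; lia.
  have lfE : (int_game n <|g G) = (n < a) by rewrite Ga lf_int.
  rewrite (times_up_int Ga) leE lfE; split=> [na|na|na k|na k].
  - apply: (far_ge0_equiv (int_times_upD _ _)); apply: far_ge0_up; lia.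
  - apply: (far_gf0_equiv (int_times_upD _ _)); apply: far_gf0_up; lia.
  - rewrite -int_times_upD; apply: up_ge_nim; lia.
  - rewrite -int_times_upD; apply: up_gf_nim; lia.
have left_move H m : is_option Left G H -> is_option Left
    (times_up G +g int_times_up m) (times_up H +g double_up_star +g int_times_up m).
  by move=> Ho; apply/option_addl/(option_times_up _ _ Gni); exists H.
have left_moveE H m : times_up H +g double_up_star +g int_times_up m
    =g times_up H +g int_times_up (2 + m) +g nim 1.
  by rewrite double_up_starE (int_times_upD 2 m) !addgA (addgAC _ (nim 1)).
have right_moveE H m : times_up H +g double_down_star +g int_times_up m
    =g times_up H +g int_times_up (m - 2) +g nim 1.
  by rewrite double_down_starE addrC (int_times_upD (- 2%:Z) m) !addgA (addgAC _ (nim 1)).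
have nimC H c k : exists d, H +g nim c +g nim k =g H +g nim d.
  by have [d _ Ed] := nim_sum c k; exists d; rewrite -Ed addgA.
have far_first : int_game n <|g G -> far_gf0 (times_up G +g int_times_up (- 1 - n)).
  case/(lf_int_option Gni)=> H Ho nH; apply: (far_gf0_of_option (left_move _ _ Ho)).
  apply: (far_ge0_equiv (symmetry (left_moveE _ _))); apply: far_ge0_nim.
  by case: (IH _ H Ho n) => /(_ nH) + _ _ _; have -> : 2 + (- 1 - n) = 1 - n by lia.
have first : int_game n <|g G ->
    forall k, game_zero <|g times_up G +g int_times_up (- n) +g nim k.
  case/(lf_int_option Gni)=> H Ho nH k.
  apply: lf_left (option_addl _ (left_move _ _ Ho)) _.
  rewrite left_moveE; have [d ->] := nimC (times_up H +g int_times_up (2 - n)) 1 k.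
  by case: (IH _ H Ho n) => _ _ /(_ nH).
have lfG : int_game n <=g G -> int_game n <|g G.
  by move=> nG; rewrite -not_le; apply/negP => Gn; apply: (Gni n).
have first_more m k : int_game n <=g G -> - n <= m ->
    game_zero <|g times_up G +g int_times_up m +g nim k.
  move=> nG nm; have -> : m = - n + (absz (m + n))%:Z by lia.
  rewrite int_times_upD; apply: lf_le_trans (first (lfG nG) k) _.
  apply: le_addr; rewrite -{1}[times_up G +g _]addg0 addgA; apply: le_addl.
  by elim: absz => // j IHj; apply: addg_ge0 up_ge0 IHj.
split=> // [nG|nG k].
  apply: far_ge0_intro => [K|k]; last by apply: first_more => //; lia.
  case/option_add=> [[_ /(option_times_up _ _ Gni)[H Ho ->] ->]|[K' K'o ->]].
    apply: (far_gf0_equiv (symmetry (right_moveE _ _))); apply: far_gf0_nim.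
    case: (IH _ H Ho n) => _ /(_ (le_right nG Ho)) + _ _.
    by have -> : 1 - n - 2 = - 1 - n by lia.
  exists 0%N => m _.
  apply: (lf_le_trans _ (le_addr _ (le_addl _ (int_times_up_right K'o)))).
  rewrite addgA; have [d ->] := nimC (times_up G +g int_times_up (1 - n - 1)) 1 m.
  by apply: first_more => //; lia.
apply/ge0P => K /option_add[[K' K'o ->]|[_ /option_nim[j _ ->] ->]]; last first.
  by apply: first_more => //; lia.
case/option_add: K'o => [[_ /(option_times_up _ _ Gni)[H Ho ->] ->]|[L Lo ->]].
  rewrite right_moveE; have [d ->] := nimC (times_up H +g int_times_up (2 - n - 2)) 1 k.
  have -> : 2 - n - 2 = - n by lia.
  by case: (IH _ H Ho n) => _ _ _ /(_ (le_right nG Ho)).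
apply: (lf_le_trans _ (le_addr _ (le_addl _ (int_times_up_right Lo)))).
rewrite addgA; have [d ->] := nimC (times_up G +g int_times_up (2 - n - 1)) 1 k.
by apply: first_more => //; lia.
Qed.

(** If n <= G fails, G.up + (1 - n).up loses for Left with a far star, whereas
    the same sum with n.up in place of G.up is up, which wins. The other
    inequality is the same for -G and -n. *)
Lemma times_up_far_inj G n : far_eq (times_up G) (int_times_up n) -> G =g int_game n.
Proof.
move=> Gn; split; rewrite -not_lf; apply/negP => GN.
  case: (times_up_far G n) => _ /(_ GN) + _ _.
  rewrite -[X in far_gf0 X]negK; apply: far_ge0_gf0_neg.
  apply: (far_eq_le0 (far_eq_sym Gn)).
  rewrite negD -!int_times_upN; apply: (far_ge0_equiv (int_times_upD _ _)).
  by apply: far_ge0_up; lia.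
case: (times_up_far (-g G) (- n)) => _.
rewrite int_gameN lf_neg => /(_ GN) + _ _.
have -> : - 1 - - n = - (1 - n) by lia.
rewrite int_times_upN times_up_neg -negD; apply: far_ge0_gf0_neg.
apply: (far_eq_ge0 (far_eq_sym Gn)); apply: (far_ge0_equiv (int_times_upD _ _)).
by apply: far_ge0_up; lia.
Qed.

(** * The atomic weight of a position *)

(** The position h has excess 0, so neither it nor its mirror image changes
    the outcome of [U n + X], and h + U n equals g. *)
Lemma position_far_eq g : all is_strip g ->
  far_eq (int_times_up (excess g)) (position_game g).
Proof.
move=> g_strip; set n := excess g; pose h := g ++ up_strips (- n).
have h_strip : all is_strip h by rewrite all_cat g_strip up_strips_strip.
have h0 : excess h = 0 by rewrite position_excess_cat up_strips_excess addrN.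
have hX X : position_game h +g (int_times_up n +g X) =g position_game g +g X.
  rewrite position_cat up_strips_game addgA -(addgA _ _ (int_times_up n)).
  by rewrite -int_times_upD addNr addg0.
have mX X : position_game (map mirror h) +g (-g (int_times_up n +g X))
    =g -g (position_game g +g X).
  by rewrite position_mirror -negD hX.
have m_strip : all is_strip (map mirror h) by rewrite all_strip_mirror.
have m0 : 0 <= excess (map mirror h) by rewrite excess_mirror h0.
have h0' : 0 <= excess h by rewrite h0.
apply: far_eqW => X far.
- exact: (far_gf0_equiv (hX X) (proj1 (position_add_far _ h_strip h0') far)).
- exact: (far_ge0_equiv (hX X) (proj2 (position_add_far _ h_strip h0') far)).
- exact: (far_gf0_equiv (mX X) (proj1 (position_add_far _ m_strip m0) far)).
- exact: (far_ge0_equiv (mX X) (proj2 (position_add_far _ m_strip m0) far)).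
Qed.

Theorem theorem2 (g : seq (seq stone)) (hg : all is_strip g) :
  game_eq (aw (position_game g)) (int_game (excess g)).
Proof.
have gE := position_far_eq hg.
have awE : far_eq (times_up (aw (position_game g))) (position_game g).
  apply: (epsilon_spec (inhabits game_zero) (fun G => far_eq (times_up G) _)).
  by exists (int_game (excess g)); rewrite (@times_up_int _ (excess g)).
apply/game_eqP/times_up_far_inj; exact: far_eq_trans awE (far_eq_sym gE).
Qed.
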